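(* Let $A$ and $B$ be unital $C^*$-algebras and suppose that $T\colon A_{+}\to B_{+}$ is a bijection. Then $T$ satisfies $$\|T(a+b)\|=\|T(a)+T(b)\|$$ for every pair $a,b\in A_{+}$ if and only if there is a Jordan $*$-isomorphism $J\colon A\to B$ such that $T(a)=T(e)^{\frac12} J(a)\, T(e)^{\frac12}$ for every $a\in A_{+}$.
   Context: The unit of any unital $C^*$-algebra is denoted by $e$. For a unital $C^*$-algebra $A$, $A_+=\{a\in A: a=a^*,\ 0\le a\}$ is the positive semidefinite cone. A Jordan $*$-isomorphism $J\colon A\to B$ is a complex-linear bijection with $J(a^2)=J(a)^2$ and $J(a^* )=J(a)^*$ for all $a\in A$. *)

(* Defs.v *)
From HB Require Import structures.
From mathcomp Require Import all_boot all_order all_algebra.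
From mathcomp Require Import complex.
From mathcomp Require Import all_classical all_reals all_analysis.

Set Implicit Arguments.
Unset Strict Implicit.
Unset Printing Implicit Defensive.

Import Order.TTheory GRing.Theory Num.Theory.
Import numFieldNormedType.Exports.

Local Open Scope classical_set_scope.
Local Open Scope ring_scope.

(* The order of the hierarchy leaves no room for a structure that inherits both
   from the rings and from the normed modules (it would sit below
   [numDomainType]), so the product [cmul] and the unit [cone] are fields here
   and the ring structure is an instance declared afterwards.  Nothing excludes
   the zero algebra, in which the unit is zero.  As for any
   [normedModType R[i]], norms are nonnegative reals seen in [R[i]]. *)
HB.mixin Record isUnitalCstarAlg (R : realType) A
    of CompleteNormedModule R[i] A := {
  cmul : A -> A -> A;
  cone : A;
  star : A -> A;
  cmulA : associative cmul;
  cmul1l : left_id cone cmul;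
  cmul1r : right_id cone cmul;
  cmulDl : left_distributive cmul +%R;
  cmulDr : right_distributive cmul +%R;
  cmulZl : forall (k : R[i]) (a b : A), cmul (k *: a) b = k *: cmul a b;
  cmulZr : forall (k : R[i]) (a b : A), cmul a (k *: b) = k *: cmul a b;
  ler_norm_cmul : forall a b : A, `|cmul a b| <= `|a| * `|b|;
  starK : involutive star;
  starD : {morph star : a b / a + b};
  starZ : forall (k : R[i]) (a : A), star (k *: a) = k^* *: star a;
  starM : forall a b : A, star (cmul a b) = cmul (star b) (star a);
  norm_starM : forall a : A, `|cmul (star a) a| = `|a| ^+ 2
}.

#[short(type="unitalCstarAlgType")]
HB.structure Definition UnitalCstarAlg (R : realType) :=
  {A of CompleteNormedModule R[i] A & isUnitalCstarAlg R A}.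

#[non_forgetful_inheritance]
HB.instance Definition _ (R : realType) (A : unitalCstarAlgType R) :=
  GRing.Zmodule_isPzRing.Build (UnitalCstarAlg.sort A)
    (@cmulA R A) (@cmul1l R A) (@cmul1r R A) (@cmulDl R A) (@cmulDr R A).

Section CstarNotions.
Context {R : realType} {A : unitalCstarAlgType R}.

Definition invertible (a : A) : Prop := exists b : A, a * b = 1 /\ b * a = 1.

Definition spectrum (a : A) : set R[i] :=
  [set z | ~ invertible (a - z *: (1 : A))].

(* In [R[i]], [0 <= z] means that [z] is real and nonnegative. *)
Definition poscone : set A :=
  [set a | star a = a /\ spectrum a `<=` [set z | 0 <= z]].

(* The unique positive [s] with [s ^+ 2 = a] when [a] is positive; the default
   value [0] is taken only when there is no such [s]. *)
Definition possqrt (a : A) : A :=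
  xget 0 [set s : A | poscone s /\ s ^+ 2 = a].

End CstarNotions.

Arguments poscone {R} A.

Definition jordan_star_isomorphism {R : realType} {A B : unitalCstarAlgType R}
    (J : A -> B) : Prop :=
  [/\ linear J,
      bijective J,
      forall a : A, J (a ^+ 2) = J a ^+ 2
    & forall a : A, J (star a) = star (J a)].

(* Main.v *)
From HB Require Import structures.
Require Import Defs.
From mathcomp Require Import all_boot all_order all_algebra.
From mathcomp Require Import complex.
From mathcomp Require Import all_classical all_reals all_analysis.
From mathcomp Require Import ring lra.
Import Order.TTheory GRing.Theory Num.Theory.
Import numFieldNormedType.Exports.
Local Open Scope classical_set_scope.
Local Open Scope ring_scope.

(* Write [S] for the inverse of [T].  If [|x + z| <= |y + z|] for all positive
   [z], then [x <= y]: take [z = |y| - y].  Hence [T] is monotone and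
   [T a <= T d] implies [T (a + b) <= T (d + b)].  For [s >= |T (a + b)|] and [c]
   with [T c = s - T (a + b)] this forces [T a + T (b + c) = s], so that [S] is
   monotone as well, and [S (x + s) = S x + S s] for real [s >= 0].  Therefore
   [S] extends to a bijection of the self-adjoint parts which maps the relation
   [- s <= x - y <= s], that is [|x - y| <= s], to
   [- S s <= S x - S y <= S s].  The Mazur-Ulam argument applies to it, so [S] and
   [T] are additive, and [T] extends to a complex linear bijection [L].  With
   [w = sqrt (T 1)], the map [J = w^-1 L w^-1] is a unital linear order
   isomorphism; Kadison's inequality [phi a ^+ 2 <= phi (a ^+ 2)] for [J] and for
   its inverse shows that [J] preserves squares.

   The positive cone is handled without spectral theory, as the union of the
   balls of radius [t] around [t 1]. *)

(* The tactic [ring] only knows commutative rings: [nc_ring] proves identities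
   of a noncommutative algebra by comparing coefficients in the free algebra. *)
Section NoncommutativeNormalization.
Context {R : realType} {A : unitalCstarAlgType R}.

Inductive ncexpr : Type :=
| NcVar of nat | NcOne | NcZero
| NcAdd of ncexpr & ncexpr | NcOpp of ncexpr | NcMul of ncexpr & ncexpr
| NcScale of R[i] & ncexpr | NcExp of ncexpr & nat | NcMuln of ncexpr & nat.

Definition ncpoly := seq (R[i] * seq nat).

Fixpoint nc_eval (env : seq A) (e : ncexpr) : A :=
  match e with
  | NcVar i => nth 0 env i
  | NcOne => 1
  | NcZero => 0
  | NcAdd e1 e2 => nc_eval env e1 + nc_eval env e2
  | NcOpp e1 => - nc_eval env e1
  | NcMul e1 e2 => nc_eval env e1 * nc_eval env e2
  | NcScale k e1 => k *: nc_eval env e1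
  | NcExp e1 n => nc_eval env e1 ^+ n
  | NcMuln e1 n => nc_eval env e1 *+ n
  end.

(* Lists are handled by functions of our own, so that [nc_normalize] can unfold
   them by name without touching the coefficients. *)
Fixpoint nc_cat (T : Type) (s t : seq T) :=
  match s with [::] => t | x :: s' => x :: nc_cat T s' t end.

Fixpoint nc_scale (k : R[i]) (p : ncpoly) : ncpoly :=
  match p with [::] => [::] | (c, w) :: p' => (k * c, w) :: nc_scale k p' end.

Fixpoint nc_mulmon (k : R[i]) (v : seq nat) (p : ncpoly) : ncpoly :=
  match p with
  | [::] => [::]
  | (c, w) :: p' => (k * c, nc_cat nat v w) :: nc_mulmon k v p'
  end.

Fixpoint nc_mul (p q : ncpoly) : ncpoly :=
  match p with
  | [::] => [::]
  | (c, w) :: p' => nc_cat _ (nc_mulmon c w q) (nc_mul p' q)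
  end.

Fixpoint nc_exp (p : ncpoly) (n : nat) : ncpoly :=
  match n with
  | 0%N => [:: (1, [::])]
  | n'.+1 => nc_mul p (nc_exp p n')
  end.

Fixpoint nc_norm (e : ncexpr) : ncpoly :=
  match e with
  | NcVar i => [:: (1, [:: i])]
  | NcOne => [:: (1, [::])]
  | NcZero => [::]
  | NcAdd e1 e2 => nc_cat _ (nc_norm e1) (nc_norm e2)
  | NcOpp e1 => nc_scale (-1) (nc_norm e1)
  | NcMul e1 e2 => nc_mul (nc_norm e1) (nc_norm e2)
  | NcScale k e1 => nc_scale k (nc_norm e1)
  | NcExp e1 n => nc_exp (nc_norm e1) n
  | NcMuln e1 n => nc_scale n%:R (nc_norm e1)
  end.

Fixpoint nc_eqn (m n : nat) :=
  match m, n with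
  | 0%N, 0%N => true
  | m'.+1, n'.+1 => nc_eqn m' n'
  | _, _ => false
  end.

Fixpoint nc_eqw (v w : seq nat) :=
  match v, w with
  | [::], [::] => true
  | i :: v', j :: w' => if nc_eqn i j then nc_eqw v' w' else false
  | _, _ => false
  end.

Fixpoint nc_coef (v : seq nat) (p : ncpoly) : R[i] :=
  match p with
  | [::] => 0
  | (c, w) :: p' => if nc_eqw v w then c + nc_coef v p' else nc_coef v p'
  end.

Fixpoint nc_rem (v : seq nat) (p : ncpoly) : ncpoly :=
  match p with
  | [::] => [::]
  | (c, w) :: p' => if nc_eqw v w then nc_rem v p' else (c, w) :: nc_rem v p'
  end.

(** The argument [n] is fuel, since [nc_rem w p'] is not a subterm; each step settles one monomial.
    Exhausted fuel yields [False], which keeps the reduction sound. *)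
Fixpoint nc_vanish (n : nat) (p : ncpoly) : Prop :=
  match p, n with
  | [::], _ => True
  | (c, w) :: p', n'.+1 => c + nc_coef w p' = 0 /\ nc_vanish n' (nc_rem w p')
  | _, 0%N => False
  end.

Fixpoint nc_evalw (env : seq A) (w : seq nat) : A :=
  match w with [::] => 1 | i :: w' => nth 0 env i * nc_evalw env w' end.

Fixpoint nc_evalp (env : seq A) (p : ncpoly) : A :=
  match p with
  | [::] => 0
  | (c, w) :: p' => c *: nc_evalw env w + nc_evalp env p'
  end.

Lemma nc_evalw_cat env v w :
  nc_evalw env (nc_cat nat v w) = nc_evalw env v * nc_evalw env w.
Proof. by elim: v => [|i v IH] /=; rewrite ?mul1r // IH mulrA. Qed.

Lemma nc_evalp_cat env p q :
  nc_evalp env (nc_cat _ p q) = nc_evalp env p + nc_evalp env q.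
Proof. by elim: p => [|[c w] p IH] /=; rewrite ?add0r // IH addrA. Qed.

Lemma nc_evalp_scale env k p : nc_evalp env (nc_scale k p) = k *: nc_evalp env p.
Proof.
by elim: p => [|[c w] p IH] /=; rewrite ?scaler0 // IH scalerDr scalerA.
Qed.

Lemma nc_evalp_mulmon env k v p :
  nc_evalp env (nc_mulmon k v p) = (k *: nc_evalw env v) * nc_evalp env p.
Proof.
elim: p => [|[c w] p IH] /=; rewrite ?mulr0 // IH mulrDr nc_evalw_cat.
by congr (_ + _); rewrite [RHS]cmulZl [X in k *: X]cmulZr scalerA.
Qed.

Lemma nc_evalp_mul env p q :
  nc_evalp env (nc_mul p q) = nc_evalp env p * nc_evalp env q.
Proof.
by elim: p => [|[c w] p IH] /=; rewrite ?mul0r //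
  nc_evalp_cat nc_evalp_mulmon IH mulrDl.
Qed.

Lemma nc_normP env e : nc_evalp env (nc_norm e) = nc_eval env e.
Proof.
elim: e => [i|||e1 IH1 e2 IH2|e1 IH1|e1 IH1 e2 IH2|k e1 IH1|e1 IH1 n|e1 IH1 n] //=.
- by rewrite scale1r mulr1 addr0.
- by rewrite scale1r addr0.
- by rewrite nc_evalp_cat IH1 IH2.
- by rewrite nc_evalp_scale IH1 scaleN1r.
- by rewrite nc_evalp_mul IH1 IH2.
- by rewrite nc_evalp_scale IH1.
- elim: n => [|n IHn] /=; first by rewrite scale1r addr0.
  by rewrite nc_evalp_mul IH1 IHn exprS.
- by rewrite nc_evalp_scale IH1 scaler_nat.
Qed.

Lemma nc_eqnP m n : nc_eqn m n -> m = n.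
Proof. by elim: m n => [|m IH] [|n] //= /IH ->. Qed.

Lemma nc_eqwP v w : nc_eqw v w -> v = w.
Proof.
by elim: v w => [|i v IH] [|j w] //=; case: ifP => // /nc_eqnP -> /IH ->.
Qed.

Lemma nc_evalp_rem env w p :
  nc_evalp env p = nc_coef w p *: nc_evalw env w + nc_evalp env (nc_rem w p).
Proof.
elim: p => [|[c v] p IH] /=; first by rewrite scale0r addr0.
case: ifP => [/nc_eqwP <-|_] /=; first by rewrite IH addrA -scalerDl.
by rewrite IH addrCA.
Qed.

Lemma nc_vanishP env n p : nc_vanish n p -> nc_evalp env p = 0.
Proof.
elim: n p => [|n IH] [|[c w] p] //= [cw0 /IH p0].
by rewrite (nc_evalp_rem env w p) addrA -scalerDl cw0 scale0r p0 addr0.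
Qed.

Lemma nc_eqP env n e1 e2 :
  nc_vanish n (nc_norm (NcAdd e1 (NcOpp e2))) -> nc_eval env e1 = nc_eval env e2.
Proof. by move=> /(nc_vanishP env); rewrite nc_normP => /subr0_eq. Qed.

End NoncommutativeNormalization.

Ltac nc_index x env :=
  lazymatch env with
  | x :: _ => constr:(0%N)
  | _ :: ?env' => let i := nc_index x env' in constr:(S i)
  end.

Ltac nc_insert x env :=
  match env with
  | nil => constr:(x :: nil)
  | x :: _ => env
  | ?y :: ?env' => let e := nc_insert x env' in constr:(y :: e)
  end.

Ltac nc_atoms t env :=
  lazymatch t with
  | @GRing.one _ => env
  | @Algebra.zero _ => env
  | @Algebra.add _ ?a ?b => let e := nc_atoms a env in nc_atoms b e
  | @Algebra.opp _ ?a => nc_atoms a env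
  | @GRing.mul _ ?a ?b => let e := nc_atoms a env in nc_atoms b e
  | @GRing.scale _ _ ?k ?a => nc_atoms a env
  | @GRing.exp _ ?a ?n => nc_atoms a env
  | @Algebra.natmul _ ?a ?n => nc_atoms a env
  | _ => nc_insert t env
  end.

Ltac nc_reify R t env :=
  lazymatch t with
  | @GRing.one _ => constr:(@NcOne R)
  | @Algebra.zero _ => constr:(@NcZero R)
  | @Algebra.add _ ?a ?b =>
      let x := nc_reify R a env in let y := nc_reify R b env in
      constr:(@NcAdd R x y)
  | @Algebra.opp _ ?a => let x := nc_reify R a env in constr:(@NcOpp R x)
  | @GRing.mul _ ?a ?b =>
      let x := nc_reify R a env in let y := nc_reify R b env in
      constr:(@NcMul R x y)
  | @GRing.scale _ _ ?k ?a =>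
      let x := nc_reify R a env in constr:(@NcScale R k x)
  | @GRing.exp _ ?a ?n => let x := nc_reify R a env in constr:(@NcExp R x n)
  | @Algebra.natmul _ ?a ?n => let x := nc_reify R a env in constr:(@NcMuln R x n)
  | _ => let i := nc_index t env in constr:(@NcVar R i)
  end.

Ltac nc_normalize :=
  lazymatch goal with
  | |- @eq ?T ?a ?b =>
    let R := open_constr:(_ : realType) in
    let A := open_constr:(_ : unitalCstarAlgType R) in
    unify T (@UnitalCstarAlg.sort R A);
    let env := nc_atoms a (@nil (@UnitalCstarAlg.sort R A)) in
    let env := nc_atoms b env in
    let x := nc_reify R a env in
    let y := nc_reify R b env in
    change (@nc_eval R A env x = @nc_eval R A env y);
    (* [1000] bounds the number of distinct monomials; what remains are equations between
       coefficients. *)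
    apply: (@nc_eqP R A env 1000%N);
    cbv beta iota delta [nc_vanish nc_norm nc_cat nc_scale nc_mulmon nc_mul
      nc_exp nc_eqn nc_eqw nc_coef nc_rem];
    repeat split
  end.

Ltac nc_ring := nc_normalize; try first [ring | by field].

(** * Norms and convergence *)

Section RealNorm.
Local Open Scope complex_scope.
Context {R : realType}.

Definition nrm (V : normedModType R[i]) (a : V) : R := complex.Re `|a|.
Arguments nrm {V} a.

Lemma normE (V : normedModType R[i]) (a : V) : `|a| = (nrm a)%:C.
Proof. by rewrite /nrm RRe_real // ger0_real. Qed.

Lemma nrm_ge0 (V : normedModType R[i]) (a : V) : 0 <= nrm a.
Proof. by rewrite -ler0c -normE. Qed.

Lemma nrmD (V : normedModType R[i]) (a b : V) : nrm (a + b) <= nrm a + nrm b.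
Proof. by rewrite -lecR rmorphD /= -!normE ler_normD. Qed.

Lemma nrm0_eq0 (V : normedModType R[i]) (a : V) : nrm a <= 0 -> a = 0.
Proof.
by move=> a0; apply/normr0_eq0/le_anti; rewrite normr_ge0 normE (lecR _ 0) a0.
Qed.

Lemma nrm0 (V : normedModType R[i]) : nrm (0 : V) = 0.
Proof. by rewrite /nrm normr0. Qed.

Lemma nrmN (V : normedModType R[i]) (a : V) : nrm (- a) = nrm a.
Proof. by rewrite /nrm normrN. Qed.

Lemma nrmB (V : normedModType R[i]) (a b : V) : nrm (a - b) = nrm (b - a).
Proof. by rewrite -nrmN opprB. Qed.

Lemma nrmBD (V : normedModType R[i]) (c a b : V) :
  nrm (a - b) <= nrm (a - c) + nrm (c - b).
Proof. by rewrite -[a - b](subrKA c) nrmD. Qed.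

Lemma nrmZ (V : normedModType R[i]) (r : R) (a : V) : nrm (r%:C *: a) = `|r| * nrm a.
Proof.
apply: (@complexI R); rewrite rmorphM /= -!normE normrZ normc_def /=.
by rewrite expr0n addr0 sqrtr_sqr.
Qed.

(** By telescoping, the increments of [e], monotone and bounded, control those of [u], which is
    therefore Cauchy. Such a numerical majorant serves both the square root and the Neumann
    series. *)
Lemma cvg_of_summable_steps (V : completeNormedModType R[i]) (u : nat -> V)
    (e : nat -> R) (K : R) :
  (forall n, nrm (u n.+1 - u n) <= e n.+1 - e n) -> (forall n, e n <= K) ->
  exists l : V, forall eps : R, 0 < eps ->
    exists N, forall n, (N <= n)%N -> nrm (u n - l) <= eps.
Proof.
move=> ue eK.
have ue2 n m : nrm (u (n + m)%N - u n) <= e (n + m)%N - e n.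
  elim: m => [|m IH]; first by rewrite addn0 !subrr nrm0.
  rewrite addnS; apply: le_trans (nrmBD _ (u (n + m)%N) _ _) _.
  by have := ue (n + m)%N; lra.
have e_mono n m : (n <= m)%N -> e n <= e m.
  by move=> /subnKC <-; rewrite -subr_ge0; apply: le_trans (ue2 _ _); exact: nrm_ge0.
have supE : has_sup (range e).
  by split; [exists (e 0%N), 0%N | exists K => _ [n _ <-]].
have tail (eps : R) : 0 < eps -> exists N, forall n, (N <= n)%N ->
    nrm (u n - u N) < eps.
  move=> eps0; have [_ [N _ <-] eN] := sup_adherent eps0 supE.
  exists N => n Nn; rewrite -(subnKC Nn); apply: le_lt_trans (ue2 _ _) _.
  by have := sup_upper_bound supE (ex_intro2 _ _ (N + (n - N))%N I erefl); lra.
have /cauchy_cvgP : cauchy (u @ \oo).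
  apply: cauchy_exP => eps eps0.
  have eps_real : eps = (complex.Re eps)%:C by rewrite RRe_real // gtr0_real.
  have [N uN] := tail (complex.Re eps) ltac:(by rewrite -ltcR -eps_real).
  exists (u N); exists N => //= n /= Nn.
  rewrite -ball_normE /= eps_real normE ltcR nrmB; exact: uN.
move=> ul; exists (lim (u @ \oo)) => eps eps0.
have /cvgrPdist_le/(_ eps%:C) := ul; rewrite ltcR => /(_ eps0)[N _ uN].
by exists N => n Nn; rewrite nrmB -lecR -normE; exact: uN.
Qed.

End RealNorm.
Arguments nrm {R V} a.

(** * Square roots *)

Lemma le_of_le_addeps {R : realType} (x y C : R) :
  (forall eps, 0 < eps -> x <= y + C * eps) -> x <= y.
Proof.
move=> xy; apply/ler_addgt0Pr => e e0.
have C0 : 0 < `|C| + 1 by rewrite ltr_wpDl.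
apply: le_trans (xy (e / (`|C| + 1)) _) _; first by rewrite divr_gt0.
rewrite lerD2l mulrA ler_pdivrMr // mulrC ler_pM2l //.
by apply: le_trans (ler_norm _) _; rewrite lerDl.
Qed.

Section CstarBasics.
Local Open Scope complex_scope.
Context {R : realType} {A : unitalCstarAlgType R}.
Implicit Types (a b h k x y z : A) (r s t : R).

Lemma nrmM a b : nrm (a * b) <= nrm a * nrm b.
Proof. by rewrite -lecR rmorphM /= -!normE; exact: ler_norm_cmul. Qed.

Lemma mulZl (c : R[i]) a b : (c *: a) * b = c *: (a * b).
Proof. exact: cmulZl. Qed.

Lemma mulZr (c : R[i]) a b : a * (c *: b) = c *: (a * b).
Proof. exact: cmulZr. Qed.

Lemma nrm_starM a : nrm (star a * a) = nrm a ^+ 2.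
Proof. by apply: (@complexI R); rewrite rmorphXn /= -!normE; exact: norm_starM. Qed.

Lemma star_mul a b : star (a * b) = star b * star a.
Proof. exact: starM. Qed.

Lemma star1 : star (1 : A) = 1.
Proof.
have := star_mul (star (1 : A)) 1.
by rewrite mulr1 starK mulr1 => /esym.
Qed.

Lemma star0 : star (0 : A) = 0.
Proof. by apply: (addrI (star 0)); rewrite -starD !addr0. Qed.

Lemma starN a : star (- a) = - star a.
Proof. by apply: (addrI (star a)); rewrite -starD !subrr star0. Qed.

Lemma starZr r a : star (r%:C *: a) = r%:C *: star a.
Proof. by rewrite starZ conj_Creal // complex_real. Qed.

Lemma starZi a : star ('i *: a) = - ('i *: star a).
Proof. by rewrite starZ conjCi scaleNr. Qed.

Lemma star_sqr a : star (a ^+ 2) = star a ^+ 2.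
Proof. by rewrite !expr2 star_mul. Qed.

Definition starE := (@starD R A, starN, starZr, starZi, star1, star0, star_sqr,
  star_mul, @starK R A).

(** The $C^*$ identity gives [nrm b ^+ 2 <= nrm (star b) * nrm b]; cancel [nrm b], then use this for
    [star a] as well. *)
Lemma nrm_star a : nrm (star a) = nrm a.
Proof.
have le_star b : nrm b <= nrm (star b).
  have := nrm_starM b; have := nrmM (star b) b; have := nrm_ge0 _ b.
  rewrite le_eqVlt => /predU1P[<-|b0 le1 eq2]; first by rewrite nrm_ge0.
  by rewrite -(ler_pM2r b0) -expr2 -eq2.
by apply/le_anti; rewrite le_star andbT -[X in _ <= nrm X]starK le_star.
Qed.

Lemma nrm_sqr_sa h : star h = h -> nrm (h ^+ 2) = nrm h ^+ 2.
Proof. by move=> hh; rewrite -nrm_starM hh expr2. Qed.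

(** Only an inequality, since the unit of the zero algebra has norm [0]. *)
Lemma nrm1_le1 : nrm (1 : A) <= 1.
Proof.
have := nrm_sqr_sa 1 star1; rewrite expr1n => n1; rewrite leNgt.
by apply/negP => n1gt; nra.
Qed.

Lemma nrm_scalar r : nrm (r%:C *: (1 : A)) <= `|r|.
Proof. by rewrite nrmZ ler_piMr // nrm1_le1. Qed.

(** The iterates of [f] from [0] are dominated by those of [g], the same iteration for the scalar
    [1], which increase within [[0, 1]]. The iterates commute, so their steps factor as differences
    of squares. The majorant covers the boundary case [nrm x = 1], where no uniform contraction is
    available. *)
Lemma quadratic_fixpoint x : nrm x <= 1 ->
  exists y, [/\ y = (2^-1)%:C *: (x + y ^+ 2), nrm y <= 1,
    star x = x -> star y = y & forall z, z * x = x * z -> z * y = y * z].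
Proof.
move=> x1.
pose f y := (2^-1)%:C *: (x + y ^+ 2); pose u n := iter n f 0.
pose g (t : R) := 2^-1 * (1 + t ^+ 2); pose e n := iter n g 0.
have uS n : u n.+1 = f (u n) by [].
have eS n : e n.+1 = g (e n) by [].
have e01 n : 0 <= e n <= 1.
  by elim: n => [|n IH]; rewrite ?lexx ?ler01 // eS /g; nra.
have u_le n : nrm (u n) <= e n.
  elim: n => [|n IH]; first by rewrite nrm0.
  rewrite uS eS nrmZ /g ger0_norm; last by lra.
  rewrite ler_pM2l; last by lra.
  apply: le_trans (nrmD _ _ _) _; apply: lerD => //.
  rewrite expr2; apply: le_trans (nrmM _ _) _; rewrite expr2.
  by apply: ler_pM => //; exact: nrm_ge0.
have u_comm z : z * x = x * z -> forall n, z * u n = u n * z.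
  move=> zx; elim=> [|n IH]; first by rewrite mulr0 mul0r.
  have sq : z * u n ^+ 2 = u n ^+ 2 * z by rewrite expr2 mulrA IH -mulrA IH mulrA.
  rewrite uS /f mulZl mulZr; congr (_ *: _).
  by rewrite [LHS]mulrDr [RHS]mulrDl zx sq.
have u_comm2 n m : u n * u m = u m * u n.
  by apply: (u_comm); apply: esym; apply: (u_comm).
have u_step n : nrm (u n.+1 - u n) <= e n.+1 - e n.
  elim: n => [|n IH].
    rewrite /u /e /= /f /g subr0 expr0n addr0 /= nrmZ ger0_norm; last lra.
    by nra.
  have -> : u n.+2 - u n.+1 = (2^-1)%:C *: ((u n.+1 - u n) * (u n.+1 + u n)).
    rewrite uS [in X in _ - X]uS /f mulrDr !mulrBl (u_comm2 n.+1 n).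
    by nc_ring.
  have -> : e n.+2 - e n.+1 = 2^-1 * ((e n.+1 - e n) * (e n.+1 + e n)).
    by rewrite eS [in X in _ - X]eS /g; ring.
  rewrite nrmZ ger0_norm; last lra.
  rewrite ler_pM2l; last lra.
  apply: le_trans (nrmM _ _) _; apply: ler_pM; rewrite ?nrm_ge0 //.
  by apply: le_trans (nrmD _ _ _) _; apply: lerD.
have [l ul] := @cvg_of_summable_steps R A u e 1 u_step (fun n => proj2 (andP (e01 n))).
have approx eps : 0 < eps -> exists n, nrm (u n - l) <= eps /\ nrm (u n.+1 - l) <= eps.
  by move=> /ul[N uN]; exists N; split; apply: uN.
have l1 : nrm l <= 1.
  apply: (@le_of_le_addeps _ _ _ 1) => eps /approx[n [un _]].
  rewrite -[l](subrK (u n)) addrC; apply: le_trans (nrmD _ _ _) _.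
  rewrite nrmB mul1r; apply: lerD => //.
  by apply: le_trans (u_le n) _; case/andP: (e01 n).
exists l; split=> //.
- apply/subr0_eq/nrm0_eq0; apply: (@le_of_le_addeps _ _ _ 2) => eps /approx[n [un un1]].
  have -> : l - (2^-1)%:C *: (x + l ^+ 2) = - (u n.+1 - l) +
      (2^-1)%:C *: (u n * (u n - l) + (u n - l) * l).
    by rewrite uS /f; nc_ring.
  rewrite add0r; apply: le_trans (nrmD _ _ _) _; rewrite nrmN nrmZ ger0_norm; last lra.
  have := nrmD _ (u n * (u n - l)) ((u n - l) * l).
  have := nrmM (u n) (u n - l); have := nrmM (u n - l) l.
  have := e01 n; have := u_le n; have := nrm_ge0 _ (u n - l); have := nrm_ge0 _ l.
  have := nrm_ge0 _ (u n).
  by nra.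
- move=> xx.
  have u_sa n : star (u n) = u n.
    elim: n => [|n IH]; first exact: star0.
    by rewrite uS /f !starE xx IH.
  apply/subr0_eq/nrm0_eq0; apply: (@le_of_le_addeps _ _ _ 2) => eps /approx[n [un _]].
  have -> : star l - l = - star (u n - l) + (u n - l).
    by rewrite !starE u_sa; nc_ring.
  by apply: le_trans (nrmD _ _ _) _; rewrite nrmN nrm_star; lra.
- move=> z zx.
  apply/subr0_eq/nrm0_eq0; apply: (@le_of_le_addeps _ _ _ (2 * nrm z)) => eps /approx[n [un _]].
  have -> : z * l - l * z = - (z * (u n - l)) + (u n - l) * z.
    by rewrite mulrBr mulrBl (u_comm z zx); nc_ring.
  apply: le_trans (nrmD _ _ _) _; rewrite nrmN.
  have := nrmM z (u n - l); have := nrmM (u n - l) z; have := nrm_ge0 _ z.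
  by nra.
Qed.

End CstarBasics.

(** * The positive cone *)

Section PositiveBalls.
Local Open Scope complex_scope.
Context {R : realType} {A : unitalCstarAlgType R}.
Implicit Types (a b h k x y z : A) (r s t : R).

(** Neumann series: [u n] is the sum of the first [n] powers of [x], dominated by a geometric
    sum. *)
Lemma invertible_1B x : nrm x < 1 -> invertible (1 - x).
Proof.
move=> x1; set r := nrm x in x1; have r0 : 0 <= r := nrm_ge0 _ x.
pose u n := iter n (fun y => 1 + x * y) (0 : A).
pose e n := iter n (fun t : R => 1 + r * t) 0.
have uS n : u n.+1 = 1 + x * u n by [].
have eS n : e n.+1 = 1 + r * e n by [].
have e_le n : e n <= (1 - r)^-1.
  elim: n => [|n IH]; first by rewrite invr_ge0 subr_ge0 ltW.
  have -> : (1 - r)^-1 = 1 + r * (1 - r)^-1 by field; rewrite subr_eq0 eq_sym lt_eqF.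
  by rewrite eS lerD2l ler_wpM2l.
have u_step n : nrm (u n.+1 - u n) <= e n.+1 - e n.
  elim: n => [|n IH]; first by rewrite /u /e /= !mulr0 !addr0 !subr0; exact: nrm1_le1.
  have -> : u n.+2 - u n.+1 = x * (u n.+1 - u n).
    by rewrite uS [in X in _ - X]uS; nc_ring.
  have -> : e n.+2 - e n.+1 = r * (e n.+1 - e n).
    by rewrite eS [in X in _ - X]eS; ring.
  by apply: le_trans (nrmM _ _) _; rewrite ler_wpM2l.
have [l ul] := @cvg_of_summable_steps R A u e _ u_step e_le.
have u_comm n : x * u n = u n * x.
  elim: n => [|n IH]; first by rewrite mulr0 mul0r.
  by rewrite uS mulrDl mulrDr mulr1 mul1r {1}IH mulrA.
have lE : l = 1 + x * l.
  apply/subr0_eq/nrm0_eq0; apply: (@le_of_le_addeps _ _ _ 2) => eps e0.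
  have [N uN] := ul _ e0.
  have -> : l - (1 + x * l) = - (u N.+1 - l) + x * (u N - l) by rewrite uS; nc_ring.
  have uN0 := uN N (leqnn N); have uN1 := uN N.+1 (leqnSn N).
  apply: le_trans (nrmD _ _ _) _; rewrite nrmN.
  have := nrmM x (u N - l); rewrite -/r; have := nrm_ge0 _ (u N - l).
  by nra.
have l_comm : x * l = l * x.
  apply/subr0_eq/nrm0_eq0; apply: (@le_of_le_addeps _ _ _ 2) => eps e0.
  have [N /(_ N (leqnn N)) uN] := ul _ e0.
  have -> : x * l - l * x = - (x * (u N - l)) + (u N - l) * x.
    by rewrite mulrBr mulrBl u_comm; nc_ring.
  apply: le_trans (nrmD _ _ _) _; rewrite nrmN.
  have := nrmM x (u N - l); have := nrmM (u N - l) x; rewrite -/r.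
  have := nrm_ge0 _ (u N - l).
  by nra.
exists l; split.
  by rewrite mulrBl mul1r {1}lE; nc_ring.
by rewrite mulrBr mulr1 -l_comm {1}lE; nc_ring.
Qed.

Lemma comm_scale z a (c : R[i]) : GRing.comm z a -> GRing.comm z (c *: a).
Proof. by rewrite /GRing.comm => za; rewrite [LHS]mulZr [RHS]mulZl; congr (_ *: _). Qed.

(* By [posconeE] below this is the positive cone; here sums are immediate, and
   square roots come from the equation [y = (x + y ^+ 2) / 2] for
   [y = 1 - sqrt (1 - x)]. *)
Definition posball a : Prop :=
  star a = a /\ exists t, nrm (t%:C *: (1 : A) - a) <= t.

Lemma posball_sa a : posball a -> star a = a. Proof. by case. Qed.

Lemma posballD a b : posball a -> posball b -> posball (a + b).
Proof.
move=> [aa [t ta]] [bb [s sb]]; split; first by rewrite starD aa bb.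
exists (t + s).
have -> : (t + s)%:C *: (1 : A) - (a + b) = (t%:C *: (1 : A) - a) + (s%:C *: (1 : A) - b) by nc_ring.
by apply: le_trans (nrmD _ _ _) _; exact: lerD.
Qed.

Lemma posballZ r a : 0 <= r -> posball a -> posball (r%:C *: a).
Proof.
move=> r0 [aa [t ta]]; split; first by rewrite starZr aa.
exists (r * t).
have -> : (r * t)%:C *: (1 : A) - r%:C *: a = r%:C *: (t%:C *: (1 : A) - a) by nc_ring.
by rewrite nrmZ ger0_norm // ler_wpM2l.
Qed.

Lemma posball_of_nrm_le t h : star h = h -> nrm h <= t -> posball (t%:C *: (1 : A) + h).
Proof.
move=> hh ht; split; first by rewrite !starE hh.
by exists t; rewrite opprD addrA subrr add0r nrmN.
Qed.

Lemma posball_scalar t : 0 <= t -> posball (t%:C *: (1 : A)).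
Proof.
move=> t0; rewrite -[_ *: _]addr0; apply: posball_of_nrm_le; first exact: star0.
by rewrite nrm0.
Qed.

(** Dividing by [t + 1], nonzero even if [t = 0], puts [1 - a / (t + 1)] in the unit ball. The
    commutation clause stands in for functional calculus. *)
Lemma posball_sqrt a : posball a ->
  exists s : A, [/\ posball s, s ^+ 2 = a & forall z, GRing.comm z a -> GRing.comm z s].
Proof.
move=> [aa [t ta]]; have t0 := le_trans (nrm_ge0 _ _) ta.
have T0 : 0 < t + 1 by lra.
pose x := 1 - (t + 1)^-1%:C *: a.
have xE : x = (t + 1)^-1%:C *: ((t + 1)%:C *: (1 : A) - a).
  by rewrite scalerBr scalerA -rmorphM mulVf ?gt_eqF // scale1r.
have x1 : nrm x <= 1.
  rewrite xE nrmZ ger0_norm; last by rewrite invr_ge0 ltW.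
  rewrite ler_pdivrMl // mulr1.
  have -> : (t + 1)%:C *: (1 : A) - a = t%:C *: (1 : A) - a + 1%:C *: (1 : A) by nc_ring.
  apply: le_trans (nrmD _ _ _) _; apply: lerD => //.
  by apply: le_trans (nrm_scalar _) _; rewrite normr1.
have xx : star x = x by rewrite !starE aa.
have [y [yE y1 /(_ xx) yy y_comm]] := quadratic_fixpoint x x1.
pose w := Num.sqrt (t + 1).
have wE : w%:C ^+ 2 = (t + 1)%:C by rewrite -rmorphXn /= sqr_sqrtr // ltW.
exists (w%:C *: (1 - y)); split.
- split; first by rewrite !starE yy.
  exists w; have -> : w%:C *: (1 : A) - w%:C *: (1 - y) = w%:C *: y by nc_ring.
  by rewrite nrmZ ger0_norm ?sqrtr_ge0 // ler_piMr // sqrtr_ge0.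
- have y2 : y ^+ 2 = 2 *: y - x.
    have -> : y ^+ 2 = 2 *: ((2^-1)%:C *: (x + y ^+ 2)) - x by nc_ring.
    by rewrite -yE.
  have -> : (w%:C *: (1 - y)) ^+ 2 = w%:C ^+ 2 *: (1 - 2 *: y + y ^+ 2) by nc_ring.
  have -> : 1 - 2 *: y + y ^+ 2 = (t + 1)^-1%:C *: a by rewrite y2 /x; nc_ring.
  by rewrite wE scalerA -rmorphM mulfV ?gt_eqF // scale1r.
- move=> z za; apply/comm_scale/commrB; first exact: commr1.
  apply: y_comm; apply: (@commrB A); first exact: commr1.
  exact: comm_scale.
Qed.

(** With [u = h + 'i *: k] one has [star u * u = r ^+ 2], so [nrm u <= r]; [h] and [h ^+ 2 - k ^+ 2]
    are the real parts of [u] and [u ^+ 2]. *)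
Lemma nrm_of_sqrD_eq h k r : star h = h -> star k = k -> GRing.comm h k ->
  0 <= r -> h ^+ 2 + k ^+ 2 = (r ^+ 2)%:C *: (1 : A) ->
  nrm h <= r /\ nrm (h ^+ 2 - k ^+ 2) <= r ^+ 2.
Proof.
move=> hh kk hk r0 hkr; pose u := h + 'i *: k.
have su : star u = h - 'i *: k by rewrite !starE hh kk.
have i2 : ('i : R[i]) * 'i = -1 by rewrite -expr2 sqrCi.
have uu : star u * u = (r ^+ 2)%:C *: (1 : A).
  rewrite -hkr su mulrBl !mulrDr [h * ('i *: k)]mulZr hk.
  by nc_normalize; rewrite ?i2; ring: i2.
have ur : nrm u <= r.
  rewrite -(@ler_pXn2r _ 2) // ?nnegrE ?nrm_ge0 // -nrm_starM uu.
  by apply: le_trans (nrm_scalar _) _; rewrite ger0_norm // sqr_ge0.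
have sur : nrm (star u) <= r by rewrite nrm_star.
split.
  have -> : h = (2^-1)%:C *: (u + star u) by rewrite su /u; nc_ring.
  rewrite nrmZ ger0_norm; last lra.
  by have := nrmD _ u (star u); lra.
have -> : h ^+ 2 - k ^+ 2 = (2^-1)%:C *: (u * u + star u * star u).
  by rewrite su /u; nc_normalize; field: i2.
rewrite nrmZ ger0_norm; last lra.
have := nrmD _ (u * u) (star u * star u).
have := nrmM u u; have := nrmM (star u) (star u); have := nrm_ge0 _ u.
by rewrite nrm_star; nra.
Qed.

(** If [k ^+ 2 = r ^+ 2 - h ^+ 2] with [r = nrm h], then [r ^+ 2 / 2 - h ^+ 2] is minus half of
    [h ^+ 2 - k ^+ 2]. *)
Lemma nrm_sqr_ball h : star h = h ->
  nrm ((nrm h ^+ 2 / 2)%:C *: (1 : A) - h ^+ 2) <= nrm h ^+ 2 / 2.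
Proof.
move=> hh; set r := nrm h; have r0 : 0 <= r := nrm_ge0 _ h.
have [k [[kk _] k2 k_comm]] : exists k : A, [/\ posball k,
    k ^+ 2 = (r ^+ 2)%:C *: (1 : A) - h ^+ 2 &
    forall z, GRing.comm z ((r ^+ 2)%:C *: (1 : A) - h ^+ 2) -> GRing.comm z k].
  apply: posball_sqrt; apply: posball_of_nrm_le; first by rewrite !starE hh.
  by rewrite nrmN (nrm_sqr_sa _ hh).
have hk : GRing.comm h k.
  apply: k_comm; apply: commrB; first by apply/comm_scale/commr1.
  exact/commrX.
have hkr : h ^+ 2 + k ^+ 2 = (r ^+ 2)%:C *: (1 : A) by rewrite k2; nc_ring.
have [_ hkB] := nrm_of_sqrD_eq _ _ _ hh kk hk r0 hkr.
have -> : (r ^+ 2 / 2)%:C *: (1 : A) - h ^+ 2 = (- 2^-1)%:C *: (h ^+ 2 - k ^+ 2).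
  by rewrite k2; nc_ring.
by rewrite nrmZ normrN ger0_norm; lra.
Qed.

Lemma posball_sqr h : star h = h -> posball (h ^+ 2).
Proof.
by move=> hh; split; [rewrite !starE hh | eexists; exact: nrm_sqr_ball].
Qed.

(** Any bound of the norm can serve as the radius in [posball]. Being a square, [a] lies in the ball
    of radius [q = nrm a / 2] around [q], and [q <= t] puts that ball inside the larger one. *)
Lemma posball_nrm_le a t : posball a -> nrm a <= t -> nrm (t%:C *: (1 : A) - a) <= t.
Proof.
move=> /posball_sqrt[s [[ss _] <- _]]; rewrite nrm_sqr_sa // => st.
set q := nrm s ^+ 2 / 2.
have -> : t%:C *: (1 : A) - s ^+ 2 = (t - q)%:C *: (1 : A) + (q%:C *: (1 : A) - s ^+ 2).
  by nc_ring.
have := nrmD _ ((t - q)%:C *: (1 : A)) (q%:C *: (1 : A) - s ^+ 2).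
have := nrm_sqr_ball s ss; rewrite -/q.
have := @nrm_scalar R A (t - q); rewrite ger0_norm; first by lra.
by rewrite /q; have := sqr_ge0 (nrm s); lra.
Qed.

(** The roots of [a] and [b] commute by their commutation clauses, so [a * b] is the square of their
    self-adjoint product. *)
Lemma posballM a b : posball a -> posball b -> GRing.comm a b -> posball (a * b).
Proof.
move=> /posball_sqrt[s [[ss _] s2 s_comm]] /posball_sqrt[r [[rr _] r2 r_comm]] ab.
have sr : GRing.comm s r by apply: r_comm; apply/commr_sym/s_comm/commr_sym.
have -> : a * b = (s * r) ^+ 2 by rewrite exprMn_comm // s2 r2.
by apply: posball_sqr; rewrite star_mul ss rr -sr.
Qed.

(** The root [k] of [(t - a) (t + a)] satisfies [a ^+ 2 + k ^+ 2 = t ^+ 2]. Together with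
    [posball_of_nrm_le], this translates between norm bounds and order bounds. *)
Lemma nrm_le_of_posball a t : 0 <= t -> posball (t%:C *: (1 : A) - a) ->
  posball (t%:C *: (1 : A) + a) -> nrm a <= t.
Proof.
move=> t0 ta_m ta_p.
have aa : star a = a.
  by have := posball_sa _ ta_p; rewrite !starE => /addrI.
have ta_comm : GRing.comm (t%:C *: (1 : A) - a) (t%:C *: (1 : A) + a).
  by rewrite /GRing.comm; nc_ring.
have [k [[kk _] k2 k_comm]] := posball_sqrt _ (posballM _ _ ta_m ta_p ta_comm).
apply: (proj1 (nrm_of_sqrD_eq a k t aa kk _ t0 _)).
  by apply: k_comm; rewrite /GRing.comm; nc_ring.
by rewrite k2; nc_ring.
Qed.

Lemma posball_anti a : posball a -> posball (- a) -> a = 0.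
Proof.
move=> a_p a_m; apply: nrm0_eq0; apply: nrm_le_of_posball => //.
  by rewrite scale0r add0r.
by rewrite scale0r add0r.
Qed.

(** [posball_nrm_le] gives the explicit radius [nrm a + t] for [a + t], so [t] can tend to [0]. *)
Lemma posball_closed a : (forall t, 0 < t -> posball (a + t%:C *: (1 : A))) -> posball a.
Proof.
move=> a_t; split.
  by have := posball_sa _ (a_t 1 ltr01); rewrite !starE => /addIr.
exists (nrm a); apply: (@le_of_le_addeps _ _ _ 2) => t t0.
have -> : (nrm a)%:C *: (1 : A) - a = (nrm a + t)%:C *: (1 : A) - (a + t%:C *: (1 : A)).
  by nc_ring.
apply: le_trans (posball_nrm_le _ _ (a_t t t0) _) _; last by lra.
apply: le_trans (nrmD _ _ _) _; have := @nrm_scalar R A t; rewrite gtr0_norm //.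
by lra.
Qed.

Lemma invertibleZ a t : 0 < t -> invertible a -> invertible (t%:C *: a).
Proof.
move=> t0 [b [ab ba]]; exists (t^-1%:C *: b).
by split; rewrite mulZl mulZr scalerA -rmorphM /= ?(mulfV, mulVf) ?gt_eqF // scale1r.
Qed.

(** With [n = nrm a], [a + t] is [(n + t) (1 - x)] where [nrm x <= n / (n + t) < 1]. *)
Lemma posball_invertible a t : posball a -> 0 < t -> invertible (a + t%:C *: (1 : A)).
Proof.
move=> a_p t0; set n := nrm a; have n0 : 0 <= n := nrm_ge0 _ a.
have nt : 0 < n + t by lra.
pose x := (n + t)^-1%:C *: (n%:C *: (1 : A) - a).
have -> : a + t%:C *: (1 : A) = (n + t)%:C *: (1 - x).
  rewrite scalerBr /x scalerA -rmorphM mulfV ?gt_eqF // scale1r.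
  by nc_ring.
apply: invertibleZ => //; apply: invertible_1B; rewrite nrmZ ger0_norm; last first.
  by rewrite invr_ge0 ltW.
rewrite ltr_pdivrMl // mulr1; apply: le_lt_trans (posball_nrm_le _ _ a_p (lexx _)) _.
by rewrite ltrDl.
Qed.

(* The infimum of the [t >= 0] with [a + t] positive is [0]: where [c = a + t] is
   positive and invertible, so is [c - d = c (1 - d c^-1)] for small [d > 0]. *)
Lemma posball_of_invertible a : star a = a ->
  (forall t, 0 < t -> invertible (a + t%:C *: (1 : A))) -> posball a.
Proof.
move=> aa a_inv.
pose E := [set t : R | 0 <= t /\ posball (a + t%:C *: (1 : A))].
have E_inf : has_inf E.
  split; last by exists 0 => t [].
  exists (nrm a); split; first exact: nrm_ge0.
  by rewrite addrC; exact: posball_of_nrm_le.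
have inf0 : 0 <= inf E by apply: lb_le_inf => [|t []//]; exact: (proj1 E_inf).
have inf_p : posball (a + (inf E)%:C *: (1 : A)).
  apply: posball_closed => e e0; have [t [_ at_p] te] := inf_adherent e0 E_inf.
  have -> : a + (inf E)%:C *: (1 : A) + e%:C *: (1 : A) =
      (a + t%:C *: (1 : A)) + (inf E + e - t)%:C *: (1 : A) by nc_ring.
  by apply: posballD => //; apply: posball_scalar; lra.
move: inf0; rewrite le_eqVlt => /predU1P[inf0|inf_gt0].
  by move: inf_p; rewrite -inf0 scale0r addr0.
set c := a + (inf E)%:C *: (1 : A) in inf_p.
have [d [cd dc]] : invertible c := a_inv _ inf_gt0.
have dd : star d = d.
  have : star d * c = 1 by rewrite -(posball_sa _ inf_p) -star_mul cd star1.
  by move=> sdc; rewrite -[star d]mulr1 -cd mulrA sdc mul1r.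
(* Small enough for [inf E - e] to be nonnegative and for [1 - e d] to be positive; adding [1]
   avoids inverting [0]. *)
pose e := Num.min (inf E) (nrm d + 1)^-1.
have d1 : 0 < nrm d + 1 by have := nrm_ge0 _ d; lra.
have e0 : 0 < e by rewrite lt_min inf_gt0 invr_gt0.
have e_inf : e <= inf E by rewrite ge_min lexx.
have ed : e * nrm d <= 1.
  have : e * (nrm d + 1) <= 1.
    by rewrite -ler_pdivlMr // div1r ge_min lexx orbT.
  by lra.
have ed_p : posball (1 - e%:C *: d).
  have -> : 1 - e%:C *: d = 1%:C *: (1 : A) + - (e%:C *: d) by nc_ring.
  apply: posball_of_nrm_le; first by rewrite !starE dd.
  by rewrite nrmN nrmZ gtr0_norm.
have cE : c * (1 - e%:C *: d) = a + (inf E - e)%:C *: (1 : A).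
  by rewrite mulrBr mulr1 [c * (_ *: _)]mulZr cd /c; nc_ring.
have : E (inf E - e).
  split; first by lra.
  rewrite -cE; apply: posballM => //; apply: commrB; first exact: commr1.
  by apply: comm_scale; rewrite /GRing.comm cd dc.
by move=> /(ge_inf (proj2 E_inf)); lra.
Qed.

(** The absence of negative spectral values is what [posball_of_invertible] asks for. Conversely,
    [posball_invertible] excludes negative reals; for [z = x + i y] with [y] nonzero it inverts
    [(a - x)^2 + y^2], of which [a - z] is a factor. *)
Lemma posconeE a : poscone A a <-> posball a.
Proof.
split=> [[aa a_spec]|a_p].
  apply: posball_of_invertible => // t t0; apply: contrapT => a_ninv.
  have /a_spec : spectrum a (- t)%:C.
    by rewrite /spectrum /= rmorphN scaleNr opprK.
  by rewrite /= ler0c; lra.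
split=> [|z]; first exact: posball_sa.
apply: contra_notP => /negP z_nge0; rewrite (complexE z).
set x := complex.Re z; set y := complex.Im z.
have aa := posball_sa _ a_p.
have [y0|y0] := eqVneq y 0.
  have x0 : x < 0.
    rewrite ltNge; apply: contra z_nge0 => x0.
    by rewrite lecE /= -/y y0 eqxx.
  rewrite y0 mulr0 addr0.
  have -> : a - x%:C *: (1 : A) = a + (- x)%:C *: (1 : A) by nc_ring.
  by apply: posball_invertible => //; lra.
have yy0 : 0 < y ^+ 2 by rewrite exprn_even_gt0.
have : star (a - x%:C *: (1 : A)) = a - x%:C *: (1 : A) by rewrite !starE aa.
move=> /posball_sqr/posball_invertible/(_ yy0)[d [cd dc]].
set b := a - x%:C *: (1 : A) in cd dc *.
have i2 : ('i%C : R[i]) * 'i%C = -1 by rewrite -expr2 sqr_i.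
set c := b ^+ 2 + _ in cd dc.
have bE : a - (x%:C + 'i%C * y%:C) *: (1 : A) = b - ('i%C * y%:C) *: (1 : A).
  by rewrite /b; nc_ring.
have cE : c = (b - ('i%C * y%:C) *: (1 : A)) * (b + ('i%C * y%:C) *: (1 : A)).
  by rewrite /c; nc_normalize; ring: i2.
have cE' : c = (b + ('i%C * y%:C) *: (1 : A)) * (b - ('i%C * y%:C) *: (1 : A)).
  by rewrite /c; nc_normalize; ring: i2.
rewrite bE.
set p := b - _ in cE cE' *; set q := b + _ in cE cE' *.
have pd_dp : d * q = q * d.
  have cq : c * q = q * c by rewrite {1}cE' {1}cE -mulrA.
  by rewrite -[d * q]mulr1 -cd mulrA -[d * q * c]mulrA -cq !mulrA dc mul1r.
exists (q * d); split; first by rewrite mulrA -cE.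
by rewrite -pd_dp -mulrA -cE'.
Qed.

End PositiveBalls.

(** * Positivity of [star y * y] and of conjugates *)

Section PositiveSquares.
Local Open Scope complex_scope.
Context {R : realType} {A : unitalCstarAlgType R}.
Implicit Types (a b c d h p q x y z : A) (r s t : R).

Lemma sqr_sa_eq0 h : star h = h -> h ^+ 2 = 0 -> h = 0.
Proof.
move=> hh h2; apply: nrm0_eq0; rewrite leNgt; apply/negP => h0.
by have := nrm_sqr_sa h hh; rewrite h2 nrm0; nra.
Qed.

(** With [h = p - q] one has [h (p + q) = 0], so the positive elements [h ^+ 2 * p] and [h ^+ 2 * q]
    are opposite, hence zero; then [h ^+ 3 = 0]. *)
Lemma posball_sqrt_uniq p q : posball p -> posball q -> GRing.comm p q ->
  p ^+ 2 = q ^+ 2 -> p = q.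
Proof.
move=> p_p q_p pq p2q2; apply: subr0_eq; set h := p - q.
have hh : star h = h by rewrite !starE (posball_sa _ p_p) (posball_sa _ q_p).
have hp : GRing.comm h p by apply/commr_sym/commrB.
have hq : GRing.comm h q by apply/commr_sym/commrB => //; exact: commr_sym.
have h2p : posball (h ^+ 2 * p).
  by apply: posballM => //; [exact: posball_sqr | exact/commr_sym/commrX/commr_sym].
have h2q : posball (h ^+ 2 * q).
  by apply: posballM => //; [exact: posball_sqr | exact/commr_sym/commrX/commr_sym].
have h2pq : h ^+ 2 * p = - (h ^+ 2 * q).
  apply/eqP; rewrite -addr_eq0 -mulrDr expr2 -mulrA.
  have -> : h * (p + q) = 0 by rewrite mulrDr !mulrBl pq -[RHS](subrr (p ^+ 2)) {2}p2q2; nc_ring.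
  by rewrite mulr0.
have h2p0 : h ^+ 2 * p = 0 by apply: posball_anti; rewrite // h2pq opprK.
have h3 : h ^+ 2 * h = 0.
  by rewrite {2}/h mulrBr -[h ^+ 2 * q]opprK -h2pq h2p0 oppr0 subr0.
apply: sqr_sa_eq0 => //; apply: sqr_sa_eq0; first by rewrite star_sqr hh.
by rewrite expr2 {2}expr2 mulrA h3 mul0r.
Qed.

(** If [g] inverts [a b + t], then [(1 - b g a) / t] inverts [b a + t]. *)
Lemma invertible_mulC a b t : 0 < t ->
  invertible (a * b + t%:C *: (1 : A)) -> invertible (b * a + t%:C *: (1 : A)).
Proof.
move=> t0 [g [abg gab]]; exists (t^-1%:C *: (1 - b * g * a)).
have abg' : a * b * g = 1 - t%:C *: g.
  by rewrite -abg mulrDl mulZl mul1r addrK.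
have gab' : g * (a * b) = 1 - t%:C *: g.
  by rewrite -gab mulrDr mulZr mulr1 addrK.
have tV : t^-1%:C *: (t%:C *: (1 : A)) = 1.
  by rewrite scalerA -rmorphM mulVf ?gt_eqF // scale1r.
rewrite mulZl mulZr; split; rewrite -[RHS]tV; congr (_ *: _).
- have -> : (b * a + t%:C *: (1 : A)) * (1 - b * g * a) =
      b * a + t%:C *: (1 - b * g * a) - b * (a * b * g) * a by nc_ring.
  by rewrite abg'; nc_ring.
- have -> : (1 - b * g * a) * (b * a + t%:C *: (1 : A)) =
      b * a + t%:C *: (1 - b * g * a) - b * (g * (a * b)) * a by nc_ring.
  by rewrite gab'; nc_ring.
Qed.

(* If [p = |b|], then [d = p - b] (twice the negative part of [b]) satisfies
   [d (p + b) = 0].  With [q = |d|] this gives [q d = 2 q p >= 0], hence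
   [q d = d ^+ 2], so that [d = q]. *)
Lemma negative_part_posball p b : star b = b -> posball p -> GRing.comm b p ->
  p ^+ 2 = b ^+ 2 -> posball (p - b).
Proof.
move=> bb p_p bp p2b2; set d := p - b; set e := p + b.
have dd : star d = d by rewrite !starE (posball_sa _ p_p) bb.
have ee : star e = e by rewrite !starE (posball_sa _ p_p) bb.
have [q [q_p q2 q_comm]] := posball_sqrt _ (posball_sqr d dd).
have qq := posball_sa _ q_p.
have comm_q z : GRing.comm z d -> GRing.comm z q by move=> zd; apply/q_comm/commrX.
have ed : GRing.comm e d.
  by rewrite /GRing.comm /e /d mulrDl !mulrBr mulrDr !mulrBl bp; nc_ring.
have de0 : d * e = 0.
  by rewrite /e /d mulrBl !mulrDr bp -[RHS](subrr (p ^+ 2)) {2}p2b2; nc_ring.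
have qe : GRing.comm q e by apply/commr_sym/comm_q.
have qe0 : q * e = 0.
  apply: sqr_sa_eq0; first by rewrite star_mul qq ee qe.
  rewrite exprMn_comm // q2 !expr2 mulrA -[d * d * e]mulrA de0.
  by rewrite mulr0 mul0r.
have dp : GRing.comm p d by apply: commrB => //; exact: commr_sym.
have qd : GRing.comm q d by apply/commr_sym/comm_q.
have qd_p : posball (q * d).
  have -> : q * d = 2%:C *: (q * p).
    rewrite -[q * d]addr0 -qe0 -mulrDr /d /e -mulZr; congr (_ * _).
    by nc_ring.
  by apply: posballZ => //; apply: posballM => //; apply/commr_sym/comm_q.
have qdd : q * d = d ^+ 2.
  apply: posball_sqrt_uniq => //; first exact: posball_sqr.
    by apply: commrX; apply/commr_sym/commrM => //; exact: commr_sym.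
  by rewrite exprMn_comm // q2 -exprD -exprM.
suff -> : d = q by [].
apply/esym/subr0_eq/sqr_sa_eq0; first by rewrite starD starN qq dd.
have -> : (q - d) ^+ 2 = q ^+ 2 - q * d - d * q + d ^+ 2 by nc_ring.
by rewrite -qd qdd q2; nc_ring.
Qed.

Lemma posball_star_mul_swap c : posball (c * star c) -> posball (star c * c).
Proof.
move=> cc_p; apply: posball_of_invertible; first by rewrite star_mul starK.
by move=> t t0; apply: invertible_mulC => //; exact: posball_invertible.
Qed.

(* Kelley--Vaught: if [d] is twice the negative part of [b = y* y] and [c = y d],
   then [c* c = - d ^+ 3 / 2 <= 0], which forces [c c* >= 0], hence [c* c >= 0]. *)
Lemma posball_star_mul y : posball (star y * y).
Proof.
set b := star y * y; have bb : star b = b by rewrite star_mul starK.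
have [p [p_p p2 p_comm]] := posball_sqrt _ (posball_sqr b bb).
have bp : GRing.comm b p by apply/p_comm/commrX.
have d_p := negative_part_posball p b bb p_p bp p2.
set d := p - b in d_p; have dd := posball_sa _ d_p.
have d2_p : posball (d ^+ 2) by exact: posball_sqr.
have d3_p : posball (2^-1%:C *: (d ^+ 2 * d)).
  apply: posballZ; first by lra.
  by apply: posballM => //; apply/commr_sym/commrX.
set c := y * d.
have cc : star c * c = - (2^-1%:C *: (d ^+ 2 * d)).
  have db : d * b = - (2^-1%:C *: d ^+ 2).
    have -> : d * b = - (2^-1%:C *: d ^+ 2) + 2^-1%:C *: (p ^+ 2 - b ^+ 2) +
        2^-1%:C *: (p * b - b * p) by rewrite /d; nc_ring.
    by rewrite p2 bp !subrr !scaler0 !addr0.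
  have -> : star c * c = d * b * d by rewrite /c star_mul dd /b !mulrA.
  by rewrite db; nc_ring.
(* [x1 ^+ 2 + x2 ^+ 2] is twice [star c * c + c * star c], with [x1] and [x2] self-adjoint, and
   [- (star c * c)] is positive. *)
have cc_p : posball (c * star c).
  pose x1 := c + star c; pose x2 := 'i *: (c - star c).
  have i2 : ('i : R[i]) * 'i = -1 by rewrite -expr2 sqrCi.
  have -> : c * star c =
      2^-1%:C *: (x1 ^+ 2 + x2 ^+ 2) + 2^-1%:C *: (d ^+ 2 * d).
    rewrite -[X in _ = _ + X]opprK -cc /x1 /x2.
    by nc_normalize; field: i2.
  apply: posballD => //; apply: posballZ; first by lra.
  by apply: posballD; apply: posball_sqr; rewrite /x1 /x2 !starE; nc_ring.
have d0 : 2^-1%:C *: (d ^+ 2 * d) = 0.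
  by apply: posball_anti => //; rewrite -cc; exact: posball_star_mul_swap.
have d3 : d ^+ 2 * d = 0.
  have -> : d ^+ 2 * d = 2%:C *: (2^-1%:C *: (d ^+ 2 * d)) by nc_ring.
  by rewrite d0 scaler0.
suff -> : b = p by [].
apply/esym/subr0_eq; apply: (sqr_sa_eq0 d) => //; apply: sqr_sa_eq0.
  by rewrite star_sqr dd.
by rewrite expr2 {2}expr2 mulrA d3 mul0r.
Qed.

Lemma posball_conj q y : posball q -> posball (star y * q * y).
Proof.
move=> /posball_sqrt[s [/posball_sa ss <- _]].
have -> : star y * s ^+ 2 * y = star (s * y) * (s * y).
  by rewrite star_mul ss; nc_ring.
exact: posball_star_mul.
Qed.

Lemma posball_sum (I : Type) (l : seq I) (F : I -> A) :
  (forall i, posball (F i)) -> posball (\sum_(i <- l) F i).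
Proof.
move=> F_p; apply: big_ind => //; last exact: posballD.
by rewrite -(scale0r (1 : A)); exact: posball_scalar.
Qed.

Lemma posball_sub_nrm a t : star a = a -> nrm a <= t -> posball (t%:C *: (1 : A) - a).
Proof. by move=> aa at_; apply: posball_of_nrm_le; rewrite ?starN ?aa // nrmN. Qed.

End PositiveSquares.

(** * Kadison's inequality *)

Section Bernstein.
Local Open Scope complex_scope.
Context {R : realType} {A : unitalCstarAlgType R}.
Variable a : A.

(* [bern n i] is the Bernstein polynomial ['C(n, i) a^i (1 - a)^(n - i)]. *)
Fixpoint bern (n i : nat) : A :=
  if n is n'.+1 then
    (1 - a) * bern n' i + a * (if i is i'.+1 then bern n' i' else 0)
  else if i is 0%N then 1 else 0.

Lemma bern_gt n i : (n < i)%N -> bern n i = 0.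
Proof.
elim: n i => [|n IH] [|i] //= ni.
by rewrite !IH ?mulr0 ?addr0 // ltnW.
Qed.

Lemma comm_bern z n i : GRing.comm z a -> GRing.comm z (bern n i).
Proof.
move=> za; elim: n i => [|n IH] [|i] /=; rewrite ?mulr0 ?addr0.
- exact: commr1.
- exact: commr0.
- by apply: commrM => //; apply: commrB => //; exact: commr1.
- by apply: commrD; apply: commrM => //; apply: commrB => //; exact: commr1.
Qed.

Lemma bern_posball n i : posball a -> posball (1 - a) -> posball (bern n i).
Proof.
move=> a_p a1_p; have a1 : GRing.comm (1 - a) a.
  by apply/commr_sym/commrB => //; exact: commr1.
elim: n i => [|n IH] [|i] /=; rewrite ?mulr0 ?addr0.
- by rewrite -(scale1r (1 : A)); apply: (@posball_scalar R A 1).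
- by rewrite -(scale0r (1 : A)); apply: (@posball_scalar R A 0).
- by apply: posballM => //; exact: comm_bern.
- by apply: posballD; apply: posballM => //; exact: comm_bern.
Qed.

(** The Bernstein polynomial of degree [n], at [a], of a function with value [f i] at [i / n]. *)
Definition bern_sum (f : nat -> R) n : A := \sum_(i < n.+1) (f i)%:C *: bern n i.

(** Pascal's recursion, read as a shift of [f]: the moments of the binomial law then follow by
    induction, without binomial coefficients. *)
Lemma bern_sumS f n :
  bern_sum f n.+1 = (1 - a) * bern_sum f n + a * bern_sum (fun i => f i.+1) n.
Proof.
rewrite /bern_sum.
have -> : \sum_(i < n.+2) (f i)%:C *: bern n.+1 i =
    (1 - a) * \sum_(i < n.+2) (f i)%:C *: bern n i +
    a * \sum_(i < n.+2) (f i)%:C *: (if val i is i'.+1 then bern n i' else 0).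
  rewrite !mulr_sumr -big_split; apply: eq_bigr => i _ /=.
  by rewrite scalerDr -!mulZr.
congr (_ * _ + _ * _).
  by rewrite big_ord_recr /= bern_gt // scaler0 addr0.
by rewrite big_ord_recl /= scaler0 add0r.
Qed.

Lemma bern_sum_ext f g n : f =1 g -> bern_sum f n = bern_sum g n.
Proof. by move=> fg; apply: eq_bigr => i _; rewrite fg. Qed.

Lemma bern_sumD f g n :
  bern_sum (fun i => f i + g i) n = bern_sum f n + bern_sum g n.
Proof.
by rewrite /bern_sum -big_split; apply: eq_bigr => i _ /=; rewrite rmorphD scalerDl.
Qed.

Lemma bern_sum1 n : bern_sum (fun=> 1) n = 1.
Proof.
elim: n => [|n IH]; first by rewrite /bern_sum big_ord1 scale1r.
by rewrite bern_sumS IH; nc_ring.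
Qed.

Lemma bern_sum_id n : bern_sum (fun i => i%:R) n = n%:R%:C *: a.
Proof.
elim: n => [|n IH]; first by rewrite /bern_sum big_ord1 !scale0r.
rewrite bern_sumS (bern_sum_ext (fun i => i.+1%:R) (fun i => i%:R + 1)).
  by rewrite bern_sumD bern_sum1 IH -[n.+1%:R]natr1; nc_ring.
by move=> i; rewrite -natr1.
Qed.

Lemma bern_sum_sqr n :
  bern_sum (fun i => i%:R ^+ 2) n =
  n%:R%:C *: a + (n%:R * (n%:R - 1))%:C *: a ^+ 2.
Proof.
elim: n => [|n IH].
  by rewrite /bern_sum big_ord1 expr0n mul0r !scale0r addr0.
rewrite bern_sumS (bern_sum_ext (fun i => i.+1%:R ^+ 2)
  (fun i => i%:R ^+ 2 + (i%:R + (i%:R + 1)))).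
  by rewrite !bern_sumD bern_sum1 bern_sum_id IH -[n.+1%:R]natr1; nc_ring.
by move=> i; rewrite -natr1; ring.
Qed.

End Bernstein.

Section Kadison.
Local Open Scope complex_scope.
Context {R : realType} {A B : unitalCstarAlgType R}.

(* The Bernstein weights [q_i = phi (bern a n i)] are positive with sum [1], and
   [0 <= \sum_i (i - n m) q_i (i - n m)] for [m = phi a] reads
   [n phi a + n (n - 1) phi (a ^+ 2) - n ^+ 2 m ^+ 2 >= 0]. *)
Lemma kadison_inequality (phi : {linear A -> B}) (a : A) :
  (forall x, posball x -> posball (phi x)) -> phi 1 = 1 ->
  posball a -> posball (1 - a) -> posball (phi (a ^+ 2) - phi a ^+ 2).
Proof.
move=> phi_p phi1 a_p a1_p; set m := phi a.
have mm : star m = m := posball_sa _ (phi_p _ a_p).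
have bernE f n : phi (bern_sum a f n) = \sum_(i < n.+1) (f i)%:C *: phi (bern a n i).
  by rewrite linear_sum; apply: eq_bigr => i _; rewrite linearZ.
have moment n :
    posball (n%:R%:C *: m + (n%:R * (n%:R - 1))%:C *: phi (a ^+ 2) -
             (n%:R ^+ 2)%:C *: m ^+ 2).
  pose N : R := n%:R; pose v (i : nat) : B := i%:R%:C *: (1 : B) - N%:C *: m.
  have vv i : star (v i) = v i by rewrite /v !starE mm.
  have : posball (\sum_(i < n.+1) star (v i) * phi (bern a n i) * v i).
    by apply: posball_sum => i; apply/posball_conj/phi_p/bern_posball.
  have -> : \sum_(i < n.+1) star (v i) * phi (bern a n i) * v i =
      \sum_(i < n.+1) (i%:R ^+ 2)%:C *: phi (bern a n i)
      - (N%:C *: m) * (\sum_(i < n.+1) i%:R%:C *: phi (bern a n i))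
      - (\sum_(i < n.+1) i%:R%:C *: phi (bern a n i)) * (N%:C *: m)
      + (N%:C *: m) * (\sum_(i < n.+1) 1%:C *: phi (bern a n i)) * (N%:C *: m).
    rewrite !mulr_sumr !mulr_suml -!sumrN -!big_split; apply: eq_bigr => i _ /=.
    by rewrite vv /v; nc_ring.
  rewrite -(bernE (fun i => i%:R ^+ 2)) -(bernE (fun i => i%:R)) -(bernE (fun=> 1)).
  rewrite bern_sum_sqr bern_sum_id bern_sum1 phi1 linearD !linearZ /= -/m.
  congr posball; rewrite /N; nc_ring.
apply: posball_closed => t t0; set x := phi (a ^+ 2) - m ^+ 2.
set z := m - phi (a ^+ 2).
have zz : star z = z.
  rewrite starD starN mm (posball_sa (phi _)) //; apply/phi_p/posball_sqr.
  exact: posball_sa.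
(* Divided by [n ^+ 2], the moment inequality reads [x + z / n >= 0]; this [n] ensures
   [z / n <= t]. *)
have [n n0 nt] : exists2 n : nat, (0 < n)%N & nrm z <= n%:R * t.
  exists (Num.truncn (nrm z / t)).+1 => //.
  by rewrite -ler_pdivrMr // ltW // truncnS_gt.
have N0 : (0 : R) < n%:R by rewrite ltr0n.
have zt_p : posball ((n%:R * t)%:C *: (1 : B) - z) by exact: posball_sub_nrm.
have -> : x + t%:C *: (1 : B) =
    (n%:R ^-2)%:C *: (n%:R%:C *: m + (n%:R * (n%:R - 1))%:C *: phi (a ^+ 2) -
             (n%:R ^+ 2)%:C *: m ^+ 2) +
    n%:R^-1%:C *: ((n%:R * t)%:C *: (1 : B) - z).
  by rewrite /x /z; nc_normalize; field; rewrite gt_eqF // ltr0n.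
by apply: posballD; apply: posballZ; rewrite // invr_ge0 ?exprn_ge0 // ltW.
Qed.

End Kadison.

(** * Unital order isomorphisms preserve squares *)

Section JordanIsomorphisms.
Local Open Scope complex_scope.
Context {R : realType} {A B : unitalCstarAlgType R}.

(** Kadison's inequality for [psi] at [phi a], transported by [phi], reverses the one for [phi] at
    [a]. This settles [0 <= a <= 1]; an affine substitution gives all self-adjoint elements, and
    polarization the rest. *)
Lemma jordan_of_order_isomorphism (phi : {linear A -> B}) (psi : {linear B -> A}) :
  cancel phi psi -> cancel psi phi ->
  (forall x, posball x -> posball (phi x)) ->
  (forall y, posball y -> posball (psi y)) ->
  phi 1 = 1 -> forall a, phi (a ^+ 2) = phi a ^+ 2.
Proof.
move=> phiK psiK phi_p psi_p phi1.
have psi1 : psi 1 = 1 by rewrite -phi1 phiK.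
have jordan01 a : posball a -> posball (1 - a) -> phi (a ^+ 2) = phi a ^+ 2.
  move=> a_p a1_p; apply: subr0_eq; apply: posball_anti.
    exact: kadison_inequality.
  rewrite opprB -[phi a ^+ 2]psiK -linearB; apply: (phi_p).
  rewrite -{2}[a]phiK; apply: kadison_inequality => //; first exact: phi_p.
  by rewrite -phi1 -linearB; exact: phi_p.
have jordan_sa h : star h = h -> phi (h ^+ 2) = phi h ^+ 2.
  (* [a] moves [h] into the interval from [0] to [1]; the added [1] keeps [r] invertible when
     [h = 0]. *)
  move=> hh; pose r := nrm h + 1; pose a := (2 * r)^-1%:C *: (r%:C *: (1 : A) + h).
  have r0 : 0 < r by have := nrm_ge0 _ h; rewrite /r; lra.
  have hr : nrm h <= r by rewrite lerDl.
  have rV0 : 0 <= (2 * r)^-1 by rewrite invr_ge0; lra.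
  have r_neq0 : 2 * r != 0 by rewrite mulf_neq0 // gt_eqF.
  have c_neq0 : (2 * r)%:C != 0 by rewrite fmorph_eq0.
  have aE : (2 * r)%:C *: a = r%:C *: (1 : A) + h.
    by rewrite scalerA -rmorphM mulfV ?scale1r.
  have hE : h = (2 * r)%:C *: a - r%:C *: (1 : A) by rewrite aE; nc_ring.
  have a_p : posball a by apply: posballZ => //; exact: posball_of_nrm_le.
  have a1_p : posball (1 - a).
    have -> : 1 - a = (2 * r)^-1%:C *: (r%:C *: (1 : A) - h).
      apply: (scalerI c_neq0); rewrite scalerBr aE scalerA -rmorphM mulfV // scale1r.
      by nc_ring.
    by apply: posballZ => //; exact: posball_sub_nrm.
  have h2E : h ^+ 2 = ((2 * r) ^+ 2)%:C *: a ^+ 2 - (4 * r ^+ 2)%:C *: a + (r ^+ 2)%:C *: (1 : A).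
    by rewrite hE; nc_ring.
  clearbody a; rewrite h2E [in RHS]hE !linearD !linearN !linearZ /=.
  rewrite (jordan01 a a_p a1_p) phi1.
  by set m := phi a; nc_ring.
move=> a; pose h := 2^-1%:C *: (a + star a); pose k := (- 'i) *: (2^-1%:C *: (a - star a)).
have i2 : ('i : R[i]) * 'i = -1 by rewrite -expr2 sqrCi.
have hh : star h = h by rewrite /h !starE addrC.
have kk : star k = k.
  by rewrite /k scaleNr !starE; nc_ring.
have aE : a = h + 'i *: k.
  by rewrite /h /k; nc_normalize; field: i2.
(* Polarization writes [x y + y x] with squares of [x], [y] and [x + y], which are self-adjoint in
   the application. *)
have sqE (x y : A) : (x + 'i *: y) ^+ 2 =
    x ^+ 2 - y ^+ 2 + 'i *: ((x + y) ^+ 2 - x ^+ 2 - y ^+ 2).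
  by nc_normalize; ring: i2.
have sqE' (x y : B) : (x + 'i *: y) ^+ 2 =
    x ^+ 2 - y ^+ 2 + 'i *: ((x + y) ^+ 2 - x ^+ 2 - y ^+ 2).
  by nc_normalize; ring: i2.
clearbody h k; rewrite aE sqE !(linearD, linearN, linearZ) /= sqE' !jordan_sa ?linearD //.
by rewrite starD hh kk.
Qed.

End JordanIsomorphisms.

(** * Mazur-Ulam *)

Section MazurUlam.
Local Open Scope complex_scope.
Context {R : realType} {V : normedModType R[i]}.
Variable D : set V.

(** Relative to [D], because the argument is applied to the self-adjoint part, a set rather than a
    type. *)
Definition isometric_bijection (g g' : V -> V) : Prop :=
  [/\ forall z, D z -> D (g z), forall z, D z -> D (g' z),
      forall z, D z -> g' (g z) = z, forall z, D z -> g (g' z) = z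
    & forall y z, D y -> D z -> nrm (g y - g z) = nrm (y - z)].

(* If [g] fixes [x] and [m + m - x], so does the conjugate
   [z |-> m + m - g^-1 (m + m - g z)], which moves [m] twice as far; but no such
   map moves [m] by more than twice the distance from [x] to [m]. *)
Lemma isometry_fixes_midpoint (m x : V) (g g' : V -> V) :
  D m -> D x -> (forall z, D z -> D (m + m - z)) ->
  isometric_bijection g g' -> g x = x -> g (m + m - x) = m + m - x -> g m = m.
Proof.
move=> Dm Dx Drefl; pose refl z := m + m - z.
have Dr z : D z -> D (refl z) by exact: Drefl.
have reflK z : refl (refl z) = z by rewrite /refl opprB addrC subrK.
have reflB y z : nrm (refl y - refl z) = nrm (y - z).
  by rewrite /refl opprB addrC addrA subrK nrmB.
(* Quantified over [g], since the induction passes to the conjugate [k], which displaces [m] twice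
   as far. *)
have bound n : forall g g', isometric_bijection g g' -> g x = x ->
    g (refl x) = refl x -> 2 ^+ n * nrm (g m - m) <= 2 * nrm (m - x).
  elim: n => [|n IH] {}g {}g' [Dg Dg' gK g'K g_iso] gx grx.
    rewrite expr0 mul1r; apply: le_trans (nrmBD _ (g x) _ _) _.
    by rewrite g_iso // gx [nrm (x - m)]nrmB; lra.
  have g'_iso y z : D y -> D z -> nrm (g' y - g' z) = nrm (y - z).
    by move=> Dy Dz; rewrite -g_iso ?g'K //; exact: Dg'.
  have g'rx : g' (refl x) = refl x by rewrite -{1}grx gK //; exact: Dr.
  pose k z := refl (g' (refl (g z))); pose k' z := g' (refl (g (refl z))).
  have k_iso : isometric_bijection k k'.
    split=> [z Dz|z Dz|z Dz|z Dz|y z Dy Dz]; rewrite /k /k'.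
    - exact/Dr/Dg'/Dr/Dg.
    - exact/Dg'/Dr/Dg/Dr.
    - by rewrite reflK g'K ?reflK ?gK //; exact/Dr/Dg.
    - by rewrite g'K ?reflK ?gK ?reflK //; [exact: Dr | exact/Dr/Dg/Dr].
    - by rewrite reflB g'_iso ?reflB ?g_iso //; exact/Dr/Dg.
  have := IH k k' k_iso.
  rewrite {1 2}/k gx g'rx reflK grx reflK.
  have -> : g' x = x by rewrite -{1}gx gK.
  move=> /(_ erefl erefl); apply: le_trans; rewrite exprSr -mulrA.
  rewrite ler_pM2l ?exprn_gt0 //.
  have -> : nrm (k m - m) = nrm (refl (g m) - g m).
    rewrite -[RHS]g'_iso ?gK //; last exact: Dg; last exact/Dr/Dg.
    by rewrite /k {1}/refl -addrA [- _ - m]addrC addrA addrK nrmB.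
  have -> : refl (g m) - g m = (- 2)%:C *: (g m - m).
    rewrite rmorphN scaleNr rmorphD /= rmorph1 scalerDl !scale1r /refl.
    by rewrite opprD !opprB [RHS]addrACA !addrA.
  by rewrite nrmZ normrN ger0_norm.
move=> g_iso gx grx; apply/subr0_eq/nrm0_eq0; rewrite leNgt; apply/negP => d0.
have two_n (n : nat) : n%:R <= 2 ^+ n :> R by rewrite -natrX ler_nat ltnW // ltn_expl.
have := bound (Num.truncn (2 * nrm (m - x) / nrm (g m - m))).+1 g g' g_iso gx grx.
apply/negP; rewrite -ltNge -ltr_pdivrMr //; apply: lt_le_trans (two_n _).
exact: truncnS_gt.
Qed.

End MazurUlam.

(** * Linear extension of additive maps on the cone *)

Section LinearExtension.
Local Open Scope complex_scope.
Context {R : realType} {A B : unitalCstarAlgType R} (T : A -> B).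
Hypothesis T_pos : forall a, posball a -> posball (T a).
Hypothesis T_add : forall a b, posball a -> posball b -> T (a + b) = T a + T b.
Implicit Types (a b h : A) (r t : R).

Let posball0 (C : unitalCstarAlgType R) : posball (0 : C).
Proof. by rewrite -(scale0r (1 : C)); exact: (@posball_scalar R C 0). Qed.

Let T0 : T 0 = 0.
Proof.
by apply: (addrI (T 0)); rewrite -T_add ?addr0 //; exact: posball0.
Qed.

Let T_mono a b : posball a -> posball (b - a) -> posball (T b - T a).
Proof.
by move=> a_p ab_p; rewrite -[b](subrK a) T_add // addrK; exact: T_pos.
Qed.

Let T_nat (n : nat) a : posball a -> T (n%:R%:C *: a) = n%:R%:C *: T a.
Proof.
move=> a_p; elim: n => [|n IH]; first by rewrite !scale0r T0.
rewrite -!natr1 !rmorphD /= !scalerDl T_add ?IH ?scale1r //.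
by apply: posballZ.
Qed.

(** With [m] the integer part of [n r], monotonicity gives [m T a <= n T (r a) <= (m + 1) T a]. So
    [n x] has norm at most [nrm (T a)] for every [n], which forces [x = 0]. *)
Lemma additive_on_posball_homogeneous r a : 0 <= r -> posball a ->
  T (r%:C *: a) = r%:C *: T a.
Proof.
move=> r0 a_p; set x := T (r%:C *: a) - r%:C *: T a; set c := nrm (T a).
have Ta_p := T_pos _ a_p; have Tra_p := T_pos _ (posballZ _ _ r0 a_p).
have c_p : posball (c%:C *: (1 : B) - T a).
  by apply: posball_sub_nrm => //; exact: posball_sa.
have c0 : 0 <= c := nrm_ge0 _ _.
have bound (n : nat) : n%:R * nrm x <= c.
  pose m := Num.truncn (n%:R * r).
  have nr0 : 0 <= n%:R * r by rewrite mulr_ge0.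
  have m_le : m%:R <= n%:R * r by rewrite truncn_le.
  have m_gt : n%:R * r < m.+1%:R by exact: truncnS_gt.
  have lo : posball (n%:R%:C *: T (r%:C *: a) - m%:R%:C *: T a).
    rewrite -!T_nat //; last exact: posballZ.
    apply: T_mono; first exact: posballZ.
    have -> : n%:R%:C *: (r%:C *: a) - m%:R%:C *: a = (n%:R * r - m%:R)%:C *: a by nc_ring.
    by apply: posballZ => //; rewrite subr_ge0.
  have hi : posball (m.+1%:R%:C *: T a - n%:R%:C *: T (r%:C *: a)).
    rewrite -!T_nat //; last exact: posballZ.
    apply: T_mono; first by do 2!apply: posballZ => //.
    have -> : m.+1%:R%:C *: a - n%:R%:C *: (r%:C *: a) = (m.+1%:R - n%:R * r)%:C *: a by nc_ring.
    by apply: posballZ => //; rewrite subr_ge0 ltW.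
  have n0 : 0 <= n%:R :> R by [].
  rewrite -[n%:R]ger0_norm // -nrmZ; apply: nrm_le_of_posball => //.
  - have -> : c%:C *: (1 : B) - n%:R%:C *: x = (c%:C *: (1 : B) - T a) +
        ((m.+1%:R%:C *: T a - n%:R%:C *: T (r%:C *: a)) + (n%:R * r - m%:R)%:C *: T a).
      by rewrite /x -[m.+1%:R]natr1; nc_ring.
    by do 2!apply: posballD => //; apply: posballZ => //; rewrite subr_ge0.
  - have -> : c%:C *: (1 : B) + n%:R%:C *: x = (c%:C *: (1 : B) - T a) +
        ((n%:R%:C *: T (r%:C *: a) - m%:R%:C *: T a) + (m.+1%:R - n%:R * r)%:C *: T a).
      by rewrite /x -[m.+1%:R]natr1; nc_ring.
    by do 2!apply: posballD => //; apply: posballZ => //; rewrite subr_ge0 ltW.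
apply/subr0_eq/nrm0_eq0; rewrite -/x leNgt; apply/negP => x0.
have := bound (Num.truncn (c / nrm x)).+1.
by apply/negP; rewrite -ltNge -ltr_pdivrMr //; exact: truncnS_gt.
Qed.

(** By [ThE], every shift [t >= 0] with [h + t] positive gives this value; [nrm h] is one choice. *)
Let Th h : B := T (h + (nrm h)%:C *: (1 : A)) - T ((nrm h)%:C *: (1 : A)).

Let ThE h t : posball (h + t%:C *: (1 : A)) -> 0 <= t -> star h = h ->
  Th h = T (h + t%:C *: (1 : A)) - T (t%:C *: (1 : A)).
Proof.
move=> ht_p t0 hh; rewrite /Th; set n := nrm h.
have n0 : 0 <= n := nrm_ge0 _ h.
have hn_p : posball (h + n%:C *: (1 : A)) by rewrite addrC; exact: posball_of_nrm_le.
apply/eqP; rewrite subr_eq addrAC eq_sym subr_eq eq_sym.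
rewrite -!T_add //; try exact: posball_scalar.
by apply/eqP; congr T; nc_ring.
Qed.

Let pos_shift h : star h = h -> posball (h + (nrm h)%:C *: (1 : A)).
Proof. by move=> hh; rewrite addrC; exact: posball_of_nrm_le. Qed.

Let ThD h1 h2 : star h1 = h1 -> star h2 = h2 -> Th (h1 + h2) = Th h1 + Th h2.
Proof.
move=> hh1 hh2; set n1 := nrm h1; set n2 := nrm h2.
have n10 : 0 <= n1 := nrm_ge0 _ h1; have n20 : 0 <= n2 := nrm_ge0 _ h2.
have E : h1 + h2 + (n1 + n2)%:C *: (1 : A) = (h1 + n1%:C *: (1 : A)) + (h2 + n2%:C *: (1 : A)).
  by nc_ring.
rewrite (ThE _ (n1 + n2)).
- rewrite E; have -> : (n1 + n2)%:C *: (1 : A) = n1%:C *: (1 : A) + n2%:C *: (1 : A) by nc_ring.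
  rewrite (T_add _ _ (pos_shift _ hh1) (pos_shift _ hh2)).
  rewrite (T_add _ _ (posball_scalar _ n10) (posball_scalar _ n20)).
  by rewrite opprD addrACA.
- by rewrite E; apply: posballD; exact: pos_shift.
- exact: addr_ge0.
- by rewrite starD hh1 hh2.
Qed.

Let Th0 : Th 0 = 0.
Proof. by rewrite /Th nrm0 add0r subrr. Qed.

Let ThN h : star h = h -> Th (- h) = - Th h.
Proof.
move=> hh; apply: (addrI (Th h)); rewrite -ThD // ?subrr //.
by rewrite starN hh.
Qed.

Let ThZ r h : star h = h -> Th (r%:C *: h) = r%:C *: Th h.
Proof.
have pos t (k : A) : 0 <= t -> star k = k -> Th (t%:C *: k) = t%:C *: Th k.
  move=> t0 kk; have E : t%:C *: k + (t * nrm k)%:C *: (1 : A) =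
      t%:C *: (k + (nrm k)%:C *: (1 : A)) by nc_ring.
  rewrite (ThE _ (t * nrm k)) ?E.
  - have -> : (t * nrm k)%:C *: (1 : A) = t%:C *: ((nrm k)%:C *: (1 : A)) by nc_ring.
    rewrite (additive_on_posball_homogeneous _ _ t0 (pos_shift _ kk)).
    rewrite (additive_on_posball_homogeneous _ _ t0 (posball_scalar _ (nrm_ge0 _ k))).
    by rewrite -scalerBr.
  - by apply: posballZ => //; exact: pos_shift.
  - by apply: mulr_ge0 => //; exact: nrm_ge0.
  - by rewrite starZr kk.
move=> hh; have [r0|/ltW r0] := leP 0 r; first exact: pos.
rewrite -[r]opprK rmorphN !scaleNr ThN ?pos //; first by rewrite oppr_ge0.
by rewrite starZr hh.
Qed.

Let Th_sa h : star h = h -> star (Th h) = Th h.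
Proof.
move=> hh; rewrite /Th starD starN !(posball_sa (T _)) //; apply: T_pos.
  exact/posball_scalar/nrm_ge0.
exact: pos_shift.
Qed.

Let re a := 2^-1%:C *: (a + star a).
Let im a := (- 'i) *: (2^-1%:C *: (a - star a)).
Let L a := Th (re a) + 'i *: Th (im a).

Let re_sa a : star (re a) = re a.
Proof. by rewrite /re !starE addrC. Qed.

Let im_sa a : star (im a) = im a.
Proof. by rewrite /im scaleNr !starE; nc_ring. Qed.

Let i2 : ('i : R[i]) * 'i = -1. Proof. by rewrite -expr2 sqrCi. Qed.

Let LD a b : L (a + b) = L a + L b.
Proof.
rewrite /L; have -> : re (a + b) = re a + re b by rewrite /re starD; nc_ring.
have -> : im (a + b) = im a + im b by rewrite /im starD; nc_ring.
by rewrite (ThD _ _ (re_sa a) (re_sa b)) (ThD _ _ (im_sa a) (im_sa b)) scalerDr addrACA.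
Qed.

Let LZr r a : L (r%:C *: a) = r%:C *: L a.
Proof.
rewrite /L; have -> : re (r%:C *: a) = r%:C *: re a by rewrite /re starZr; nc_ring.
have -> : im (r%:C *: a) = r%:C *: im a by rewrite /im starZr; nc_ring.
by rewrite (ThZ r _ (re_sa a)) (ThZ r _ (im_sa a)) [RHS]scalerDr !scalerA mulrC.
Qed.

Let LZi a : L ('i *: a) = 'i *: L a.
Proof.
rewrite /L; have -> : re ('i *: a) = - im a.
  by rewrite /re /im starZi; nc_ring.
have -> : im ('i *: a) = re a.
  by rewrite /re /im starZi; nc_normalize; field: i2.
by rewrite (ThN _ (im_sa a)) [RHS]scalerDr scalerA i2 scaleN1r addrC.
Qed.

Let L_linear : linear L.
Proof.
move=> c a b; rewrite LD; congr (_ + _).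
have -> : c = (complex.Re c)%:C + 'i * (complex.Im c)%:C by rewrite {1}(complexE c).
by rewrite !scalerDl LD LZr -!scalerA LZi LZr.
Qed.

Lemma linear_extension_of_additive : exists L : {linear A -> B},
  (forall a, L (star a) = star (L a)) /\ (forall a, posball a -> L a = T a).
Proof.
pose LL : {linear A -> B} := HB.pack L (GRing.isLinear.Build _ _ _ _ L L_linear).
exists LL; split=> [a|a a_p] /=; rewrite /L.
  have -> : re (star a) = re a by rewrite /re starK addrC.
  have -> : im (star a) = - im a by rewrite /im starK; nc_ring.
  by rewrite (ThN _ (im_sa a)) starD starZi (Th_sa _ (re_sa a)) (Th_sa _ (im_sa a)) scalerN.
have aa := posball_sa _ a_p.
have -> : re a = a by rewrite /re aa; nc_ring.
have -> : im a = 0 by rewrite /im aa subrr !scaler0.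
by rewrite Th0 scaler0 addr0 (ThE _ 0) ?scale0r ?T0 ?addr0 ?subr0.
Qed.

End LinearExtension.

(** * Norm-additive bijections *)

Section NormOrder.
Local Open Scope complex_scope.
Context {R : realType} {A : unitalCstarAlgType R}.
Implicit Types (x y z : A).

Lemma posball_le_nrm x y : posball x -> posball (y - x) -> nrm x <= nrm y.
Proof.
move=> x_p xy_p; have y_p : posball y by rewrite -(subrK x y); exact: posballD.
apply: nrm_le_of_posball; first exact: nrm_ge0.
  have -> : (nrm y)%:C *: (1 : A) - x = ((nrm y)%:C *: (1 : A) - y) + (y - x) by nc_ring.
  by apply: posballD => //; apply: posball_sub_nrm => //; exact: posball_sa.
by apply: posballD => //; exact/posball_scalar/nrm_ge0.
Qed.

(* Take [z = t - y] with [t = |y|]: then [|t - (y - x)| <= t]. *)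
Lemma posball_of_nrm_addr_le x y : posball x -> posball y ->
  (forall z, posball z -> nrm (x + z) <= nrm (y + z)) -> posball (y - x).
Proof.
move=> x_p y_p xy; have yy := posball_sa _ y_p.
split; first by rewrite starD starN yy (posball_sa _ x_p).
have := xy _ (posball_sub_nrm y _ yy (lexx _)); set t := nrm y => xy_t.
exists t; apply: le_trans (_ : nrm (y + (t%:C *: (1 : A) - y)) <= _).
  by apply: le_trans xy_t; rewrite opprB addrCA addrC lexx.
rewrite addrC subrK; apply: le_trans (nrm_scalar _) _.
by rewrite ger0_norm // nrm_ge0.
Qed.

End NormOrder.

(** * Order properties and additivity of norm-additive bijections *)

Section NormAdditive.
Local Open Scope complex_scope.
Context {R : realType} {A B : unitalCstarAlgType R} (T : A -> B) (S : B -> A).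
Hypothesis T_pos : forall a, posball a -> posball (T a).
Hypothesis S_pos : forall x, posball x -> posball (S x).
Hypothesis TK : forall a, posball a -> S (T a) = a.
Hypothesis SK : forall x, posball x -> T (S x) = x.
Hypothesis T_norm : forall a b, posball a -> posball b ->
  nrm (T (a + b)) = nrm (T a + T b).
Implicit Types (a b c d : A) (x y z : B) (s t : R).

Let scal0 (C : unitalCstarAlgType R) : posball (0 : C).
Proof. by rewrite -(scale0r (1 : C)); exact: (@posball_scalar R C 0). Qed.

Let T0 : T 0 = 0.
Proof.
have := T_norm 0 0 (scal0 A) (scal0 A); rewrite addr0 => T00.
apply: nrm0_eq0; move: T00; have -> : T 0 + T 0 = 2%:C *: T 0 by nc_ring.
by rewrite nrmZ ger0_norm //; lra.
Qed.

(** Both sides are the norm of [T (a + b + c)]; this lets [b] pass between the two arguments. *)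
Let T_assoc a b c : posball a -> posball b -> posball c ->
  nrm (T (a + b) + T c) = nrm (T a + T (b + c)).
Proof.
move=> a_p b_p c_p; rewrite -!T_norm ?addrA //; exact: posballD.
Qed.

(** For [z = T c], the norm of [T b + T c] is that of [T (b - a) + T (a + c)], which dominates
    [T (a + c)]. *)
Let T_mono a b : posball a -> posball (b - a) -> posball (T b - T a).
Proof.
move=> a_p ab_p; have b_p : posball b by rewrite -(subrK a b); exact: posballD.
apply: posball_of_nrm_addr_le => [||z z_p]; try exact: T_pos.
have c_p := S_pos _ z_p; rewrite -(SK _ z_p); set c := S z in c_p *.
have -> : nrm (T b + T c) = nrm (T (b - a) + T (a + c)).
  by rewrite -!T_norm ?addrA ?subrK //; exact: posballD.
rewrite -T_norm //; apply: posball_le_nrm; first exact/T_pos/posballD.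
by rewrite addrK; exact: T_pos.
Qed.

Let T_addr_mono a b d : posball a -> posball b -> posball d ->
  posball (T d - T a) -> posball (T (d + b) - T (a + b)).
Proof.
move=> a_p b_p d_p ad_p.
apply: posball_of_nrm_addr_le => [||z z_p]; try exact/T_pos/posballD.
have c_p := S_pos _ z_p; rewrite -(SK _ z_p) !T_assoc //.
apply: posball_le_nrm; first by apply: posballD; apply: T_pos => //; exact: posballD.
by rewrite opprD addrACA subrr addr0.
Qed.

Let nrm_scal s : 0 <= s -> nrm (s%:C *: (1 : B)) <= s.
Proof. by move=> s0; apply: le_trans (nrm_scalar _) _; rewrite ger0_norm. Qed.

(** Let [T c = s - T (a + b)] and [T d = s - T (b + c)]. By [T_assoc], [T a + T (b + c)] and
    [T (d + b) + T c] have norm at most [s]. The first bound gives [T a <= T d], hence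
    [T (a + b) <= T (d + b)]; the second gives the converse. So [d = a]. *)
Let key a b s : posball a -> posball b -> 0 <= s ->
  posball (s%:C *: (1 : B) - T (a + b)) ->
  T a + T (b + S (s%:C *: (1 : B) - T (a + b))) = s%:C *: (1 : B).
Proof.
move=> a_p b_p s0; set e := s%:C *: (1 : B) => ab_p.
have c_p := S_pos _ ab_p; have Tc := SK _ ab_p.
set c := S (e - T (a + b)) in c_p Tc *.
have Ta_p := T_pos _ a_p; have Tbc_p := T_pos _ (posballD _ _ b_p c_p).
have le1 : nrm (T a + T (b + c)) <= s.
  by rewrite -T_assoc // Tc addrC subrK; exact: nrm_scal.
have sbc_p : posball (e - T (b + c)).
  have -> : e - T (b + c) = (e - (T a + T (b + c))) + T a by nc_ring.
  apply: posballD => //; apply: posball_sub_nrm => //; apply: posball_sa.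
  exact: posballD.
have d_p := S_pos _ sbc_p; have Td := SK _ sbc_p.
set d := S (e - T (b + c)) in d_p Td *.
have le2 : nrm (T (d + b) + T c) <= s.
  by rewrite T_assoc // Td subrK; exact: nrm_scal.
have db_ab : posball (T (a + b) - T (d + b)).
  have -> : T (a + b) - T (d + b) = e - (T (d + b) + T c) by rewrite Tc; nc_ring.
  apply: posball_sub_nrm => //; apply: posball_sa.
  by apply: posballD; apply: T_pos => //; exact: posballD.
have ab_db : posball (T (d + b) - T (a + b)).
  apply: T_addr_mono => //; rewrite Td.
  have -> : e - T (b + c) - T a = e - (T a + T (b + c)) by nc_ring.
  by apply: posball_sub_nrm => //; apply: posball_sa; exact: posballD.
have : T (d + b) = T (a + b).
  by apply/subr0_eq/posball_anti => //; rewrite opprB.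
move=> /(congr1 S); rewrite !TK; try exact: posballD.
by move=> /addIr <-; rewrite Td subrK.
Qed.

(** For [T a = s - x], [key] provides a positive [c] with [T (b + c) = s - T a = x], that is
    [S x = b + c]. *)
Let S_mono b x : posball b -> posball x -> posball (x - T b) -> posball (S x - b).
Proof.
move=> b_p x_p bx_p; set s := nrm x; have s0 : 0 <= s := nrm_ge0 _ x.
have sx_p : posball (s%:C *: (1 : B) - x).
  by apply: posball_sub_nrm => //; exact: posball_sa.
have a_p := S_pos _ sx_p; have Ta := SK _ sx_p.
set a := S (s%:C *: (1 : B) - x) in a_p Ta.
have Tab_p : posball (T a + T b) by apply: posballD; exact: T_pos.
have ab_s : nrm (T (a + b)) <= s.
  rewrite T_norm //; apply: nrm_le_of_posball => //.
    have -> : s%:C *: (1 : B) - (T a + T b) = x - T b by rewrite Ta; nc_ring.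
    by [].
  by apply: posballD => //; exact: posball_scalar.
have sab_p : posball (s%:C *: (1 : B) - T (a + b)).
  by apply: posball_sub_nrm => //; exact/posball_sa/T_pos/posballD.
have c_p := S_pos _ sab_p; have := key a b s a_p b_p s0 sab_p.
set c := S _ in c_p *; move=> kE.
have Tbc : T (b + c) = x by apply: (addrI (T a)); rewrite kE Ta subrK.
by rewrite -Tbc TK ?[b + c]addrC ?addrK //; exact: posballD.
Qed.

Let S_refl x s : 0 <= s -> posball x -> posball (s%:C *: (1 : B) - x) ->
  S x + S (s%:C *: (1 : B) - x) = S (s%:C *: (1 : B)).
Proof.
move=> s0 x_p sx_p; have := key 0 (S x) s (scal0 A) (S_pos _ x_p) s0.
rewrite add0r SK // T0 add0r => /(_ sx_p) E.
by rewrite -[in RHS]E TK //; apply: posballD; exact: S_pos.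
Qed.

(** The complement of [x + s] in [n + s] is that of [x] in [n]; compare the instances of [S_refl]
    for these two and for [s] in [n + s]. *)
Let S_shift x s : 0 <= s -> posball x ->
  S (x + s%:C *: (1 : B)) = S x + S (s%:C *: (1 : B)).
Proof.
move=> s0 x_p; set n := nrm x; have n0 : 0 <= n := nrm_ge0 _ x.
have nx_p : posball (n%:C *: (1 : B) - x).
  by apply: posball_sub_nrm => //; exact: posball_sa.
have s_p : posball (s%:C *: (1 : B)) by exact: posball_scalar.
have n_p : posball (n%:C *: (1 : B)) by exact: posball_scalar.
have ns0 : 0 <= n + s by exact: addr_ge0.
have E1 : (n + s)%:C *: (1 : B) - (x + s%:C *: (1 : B)) = n%:C *: (1 : B) - x by nc_ring.
have E2 : (n + s)%:C *: (1 : B) - s%:C *: (1 : B) = n%:C *: (1 : B) by nc_ring.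
have := S_refl _ _ ns0 (posballD _ _ x_p s_p); rewrite E1 => /(_ nx_p).
have := S_refl _ _ ns0 s_p; rewrite E2 => /(_ n_p) <-.
rewrite -(S_refl x n n0 x_p nx_p) => SE.
apply: (addIr (S (n%:C *: (1 : B) - x))); rewrite SE.
by rewrite addrA [S (s%:C *: _) + _]addrC.
Qed.

Let sa (C : unitalCstarAlgType R) : set C := [set x | star x = x].

(** The extension of [S] to self-adjoint elements. Additivity is not yet known, and [S_shift] is
    what makes the value independent of the shift. *)
Let F x : A := S (x + (nrm x)%:C *: (1 : B)) - S ((nrm x)%:C *: (1 : B)).

Let shift_pos x t : star x = x -> nrm x <= t -> posball (x + t%:C *: (1 : B)).
Proof. by move=> xx xt; rewrite addrC; exact: posball_of_nrm_le. Qed.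

Let FE x t : 0 <= t -> star x = x -> posball (x + t%:C *: (1 : B)) ->
  F x = S (x + t%:C *: (1 : B)) - S (t%:C *: (1 : B)).
Proof.
move=> t0 xx xt_p; set n := nrm x; have n0 : 0 <= n := nrm_ge0 _ x.
have xn_p := shift_pos x n xx (lexx _).
have E := S_shift _ _ n0 xt_p; have E' := S_shift _ _ t0 xn_p.
rewrite addrAC E' in E.
by apply/eqP; rewrite /F -/n subr_eq addrAC eq_sym subr_eq E.
Qed.

Let F_sa x : star x = x -> star (F x) = F x.
Proof.
move=> xx; rewrite /F starD starN !(posball_sa (S _)) //; apply: S_pos.
  exact/posball_scalar/nrm_ge0.
exact: shift_pos.
Qed.

Let F_pos x : posball x -> F x = S x.
Proof.
move=> x_p; have S0 : S 0 = 0 by rewrite -T0 TK.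
by rewrite (FE x 0) ?scale0r ?addr0 ?S0 ?subr0 //; exact: posball_sa.
Qed.

Let F_le x y : star x = x -> star y = y -> posball (y - x) <-> posball (F y - F x).
Proof.
move=> xx yy; set t := nrm x + nrm y.
have t0 : 0 <= t by rewrite addr_ge0 ?nrm_ge0.
have x_p : posball (x + t%:C *: (1 : B)) by apply: shift_pos; rewrite // lerDl nrm_ge0.
have y_p : posball (y + t%:C *: (1 : B)) by apply: shift_pos; rewrite // lerDr nrm_ge0.
have Fyx : F y - F x = S (y + t%:C *: (1 : B)) - S (x + t%:C *: (1 : B)).
  by rewrite (FE x t) // (FE y t) // opprB addrA subrK.
have yx : y - x = (y + t%:C *: (1 : B)) - (x + t%:C *: (1 : B)) by nc_ring.
rewrite Fyx yx; split=> yx_p.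
  by apply: S_mono => //; [exact: S_pos | rewrite SK].
by rewrite -(SK _ x_p) -(SK _ y_p); apply: T_mono => //; exact: S_pos.
Qed.

Let F_shift x s : 0 <= s -> star x = x ->
  F (x + s%:C *: (1 : B)) = F x + S (s%:C *: (1 : B)).
Proof.
move=> s0 xx; set n := nrm x; have n0 : 0 <= n := nrm_ge0 _ x.
have xn_p := shift_pos x n xx (lexx _).
have E : x + s%:C *: (1 : B) + n%:C *: (1 : B) = (x + n%:C *: (1 : B)) + s%:C *: (1 : B).
  by nc_ring.
rewrite (FE _ n) ?E //.
- by rewrite S_shift // (FE x n) // addrAC.
- by rewrite !starE xx.
- by apply: posballD => //; exact: posball_scalar.
Qed.

Let F_inj x y : star x = x -> star y = y -> F x = F y -> x = y.
Proof.
move=> xx yy Fxy; apply/subr0_eq/posball_anti; first by apply/F_le; rewrite // Fxy subrr.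
by rewrite opprB; apply/F_le; rewrite // Fxy subrr.
Qed.

(** Since [T n <= t], [S_mono] gives [n <= S t]; so [a + S t] is positive, and [T (a + S t) - t] is
    a preimage of [a]. *)
Let F_surj a : star a = a -> exists2 x, star x = x & F x = a.
Proof.
move=> aa; set n := nrm a; have n0 : 0 <= n := nrm_ge0 _ a.
have n_p : posball (n%:C *: (1 : A)) by exact: posball_scalar.
have y_p := T_pos _ n_p; set y := T (n%:C *: (1 : A)) in y_p *.
set t := nrm y; have t0 : 0 <= t := nrm_ge0 _ y.
have t_p : posball (t%:C *: (1 : B)) by exact: posball_scalar.
have at_p : posball (a + S (t%:C *: (1 : B))).
  have -> : a + S (t%:C *: (1 : B)) =
      (n%:C *: (1 : A) + a) + (S (t%:C *: (1 : B)) - n%:C *: (1 : A)) by nc_ring.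
  apply: posballD; first exact: posball_of_nrm_le.
  by apply: S_mono => //; apply: posball_sub_nrm => //; exact: posball_sa.
have z_p := T_pos _ at_p; set z := T (a + S (t%:C *: (1 : B))) in z_p *.
have xx : star (z - t%:C *: (1 : B)) = z - t%:C *: (1 : B).
  by rewrite !starE (posball_sa _ z_p).
exists (z - t%:C *: (1 : B)) => //.
by rewrite (FE _ t) ?subrK // /z TK // addrK.
Qed.

Let G a : B := xget 0 [set x | star x = x /\ F x = a].

Let GP a : star a = a -> star (G a) = G a /\ F (G a) = a.
Proof.
move=> aa; have [x xx Fx] := F_surj a aa.
by apply: (@xgetPex _ 0 [set x | star x = x /\ F x = a]); exists x.
Qed.

(** The map [F] need not be isometric, but it turns norm balls into order intervals that are
    symmetric under negation of [F x - F y]. Conjugating a point reflection by [F] therefore gives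
    an isometry. *)
Let F_dist x y s : 0 <= s -> star x = x -> star y = y ->
  nrm (x - y) <= s <->
  posball (S (s%:C *: (1 : B)) - (F x - F y)) /\
  posball (S (s%:C *: (1 : B)) + (F x - F y)).
Proof.
move=> s0 xx yy; have xy_sa : star (x - y) = x - y by rewrite !starE xx yy.
have ss : star (s%:C *: (1 : B)) = s%:C *: (1 : B) by rewrite !starE.
have E1 : S (s%:C *: (1 : B)) - (F x - F y) = F (y + s%:C *: (1 : B)) - F x.
  by rewrite F_shift //; nc_ring.
have E2 : S (s%:C *: (1 : B)) + (F x - F y) = F (x + s%:C *: (1 : B)) - F y.
  by rewrite F_shift //; nc_ring.
rewrite E1 E2; split=> [xy_s|[/F_le xy1 /F_le xy2]].
  split; apply/F_le; rewrite // ?starD ?xx ?yy ?ss //.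
    have -> : y + s%:C *: (1 : B) - x = s%:C *: (1 : B) - (x - y) by nc_ring.
    exact: posball_sub_nrm.
  have -> : x + s%:C *: (1 : B) - y = s%:C *: (1 : B) + (x - y) by nc_ring.
  exact: posball_of_nrm_le.
apply: nrm_le_of_posball => //.
  have -> : s%:C *: (1 : B) - (x - y) = y + s%:C *: (1 : B) - x by nc_ring.
  by apply: xy1; rewrite // starD yy ss.
have -> : s%:C *: (1 : B) + (x - y) = x + s%:C *: (1 : B) - y by nc_ring.
by apply: xy2; rewrite // starD xx ss.
Qed.

(** The conjugate [H] by [F] of the reflection exchanging [F x] and [F y] is an isometry exchanging
    [x] and [y]. Composed with the reflection [r] in [m], it fixes both points, hence [m]; so
    [H m = m], which is the claim. *)
Let F_midpoint x y m : star x = x -> star y = y -> m + m = x + y -> star m = m ->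
  F m + F m = F x + F y.
Proof.
move=> xx yy mxy mm.
pose r' a := F x + F y - a; pose H z := G (r' (F z)); pose r z := m + m - z.
have r'_sa a : star a = a -> star (r' a) = r' a.
  move=> aa; rewrite /r' starD starN aa.
    by rewrite [star (F x + F y)]starD (F_sa x) // (F_sa y).
have r_sa z : star z = z -> star (r z) = r z.
  by move=> zz; rewrite /r !starD starN mm zz.
have rK z : r (r z) = z by rewrite /r opprB addrC subrK.
have H_sa z : star z = z -> star (H z) = H z.
  by move=> zz; exact: (proj1 (GP _ (r'_sa _ (F_sa _ zz)))).
have FH z : star z = z -> F (H z) = r' (F z).
  by move=> zz; exact: (proj2 (GP _ (r'_sa _ (F_sa _ zz)))).
have HK z : star z = z -> H (H z) = z.
  move=> zz; apply: F_inj => //; first exact/H_sa/H_sa.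
  by rewrite !FH ?H_sa // /r' opprB addrC subrK.
have H_dist u z s : 0 <= s -> star u = u -> star z = z ->
    nrm (u - z) <= s -> nrm (H u - H z) <= s.
  move=> s0 uu zz /(F_dist _ _ _ s0 uu zz)[uz1 uz2].
  apply/F_dist => //; try exact: H_sa.
  have -> : F (H u) - F (H z) = - (F u - F z) by rewrite !FH // /r'; nc_ring.
  by rewrite opprK.
have H_iso u z : star u = u -> star z = z -> nrm (H u - H z) = nrm (u - z).
  move=> uu zz; apply/le_anti/andP; split; first by apply: H_dist => //; exact: nrm_ge0.
  rewrite -{1}(HK u uu) -{1}(HK z zz).
  by apply: H_dist; rewrite ?nrm_ge0 // H_sa.
have Hx : H x = y.
  by apply: F_inj => //; [exact: H_sa | rewrite FH // /r' addrC addKr].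
have Hy : H y = x by rewrite -Hx HK.
have rx : r x = y by rewrite /r mxy addrC addKr.
have ry : r y = x by rewrite -rx rK.
have g_iso : isometric_bijection (sa B) (fun z => r (H z)) (fun z => H (r z)).
  split=> [z zz|z zz|z zz|z zz|u z uu zz].
  - exact/r_sa/H_sa.
  - exact/H_sa/r_sa.
  - by rewrite rK HK.
  - by rewrite HK ?rK //; exact: r_sa.
  - rewrite -[RHS]H_iso // /r -[RHS]nrmB.
    by congr nrm; nc_ring.
have gx : r (H x) = x by rewrite Hx.
have gy : r (H (m + m - x)) = m + m - x by rewrite -/(r x) rx Hy rx.
have gm := isometry_fixes_midpoint (sa B) m x _ _ mm xx r_sa g_iso gx gy.
have Hm : H m = m.
  by have := congr1 r gm; rewrite rK => ->; rewrite /r addrK.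
by rewrite -{1}Hm FH // /r' subrK.
Qed.

Let F_add x y : star x = x -> star y = y -> F (x + y) = F x + F y.
Proof.
move=> xx yy; pose m := 2^-1%:C *: (x + y).
have mm : star m = m by rewrite /m starZr starD xx yy.
have m2 : m + m = x + y by rewrite /m; nc_ring.
have F0 : F 0 = 0 by rewrite F_pos // -T0 TK.
(* [m] is also the midpoint of [x + y] and [0]. *)
rewrite -(F_midpoint x y m) // (F_midpoint (x + y) 0 m) ?F0 ?addr0 //.
  by rewrite starD xx yy.
exact: star0.
Qed.

Lemma additive_of_norm_additive a b : posball a -> posball b -> T (a + b) = T a + T b.
Proof.
move=> a_p b_p; have Ta_p := T_pos _ a_p; have Tb_p := T_pos _ b_p.
rewrite -{1}(TK _ a_p) -{1}(TK _ b_p) -!F_pos //.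
rewrite -F_add; try exact: posball_sa.
by rewrite F_pos ?SK //; exact: posballD.
Qed.

End NormAdditive.

(** * From additive bijections to Jordan isomorphisms *)

Section JordanFromAdditive.
Local Open Scope complex_scope.
Context {R : realType} {A B : unitalCstarAlgType R}.

Lemma eq_linear_on_posball (phi psi : {linear A -> B}) :
  (forall a, posball a -> phi a = psi a) -> phi =1 psi.
Proof.
move=> eq_p.
have eq_sa h : star h = h -> phi h = psi h.
  move=> hh; have n0 := nrm_ge0 _ h.
  have -> : h = ((nrm h)%:C *: (1 : A) + h) - (nrm h)%:C *: (1 : A) by nc_ring.
  by rewrite !linearB !eq_p //; [exact: posball_scalar | exact: posball_of_nrm_le].
move=> a; pose h := 2^-1%:C *: (a + star a).
pose k := (- 'i) *: (2^-1%:C *: (a - star a)).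
have i2 : ('i : R[i]) * 'i = -1 by rewrite -expr2 sqrCi.
have hh : star h = h by rewrite /h !starE addrC.
have kk : star k = k by rewrite /k scaleNr !starE; nc_ring.
have aE : a = h + 'i *: k by rewrite /h /k; nc_normalize; field: i2.
by clearbody h k; rewrite aE !linearD !linearZ /= !eq_sa.
Qed.

(** Self-adjointness of [u] lets [posball_conj] apply to conjugation by the inverse of [w]. *)
Lemma invertible_sqr_sa (w : A) : star w = w -> invertible (w ^+ 2) ->
  exists u : A, [/\ star u = u, w * u = 1 & u * w = 1].
Proof.
move=> ww [b [w2b bw2]]; have wu : w * (w * b) = 1 by rewrite mulrA -expr2.
have uw : (w * b) * w = 1.
  suff -> : w * b = b * w by rewrite -mulrA -expr2.
  by rewrite -[w * b]mul1r -bw2 expr2 -!mulrA wu mulr1.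
have sbw : star b * w * w = 1.
  by rewrite -mulrA -expr2 -[w ^+ 2]starK star_sqr ww -star_mul w2b star1.
exists (w * b); split=> //.
by rewrite star_mul ww -[LHS]mulr1 -wu mulrA sbw mul1r.
Qed.

End JordanFromAdditive.

Section NormAdditiveBijections.
Local Open Scope complex_scope.
Context {R : realType} {A B : unitalCstarAlgType R}.

Lemma jordan_of_additive_bijection (T : A -> B) (S : B -> A) (w : B) :
  (forall a, posball a -> posball (T a)) ->
  (forall x, posball x -> posball (S x)) ->
  (forall a, posball a -> S (T a) = a) -> (forall x, posball x -> T (S x) = x) ->
  (forall a b, posball a -> posball b -> T (a + b) = T a + T b) ->
  posball w -> w ^+ 2 = T 1 ->
  exists J : A -> B, jordan_star_isomorphism J /\
    forall a, posball a -> T a = w * J a * w.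
Proof.
move=> T_pos S_pos TK SK T_add w_p w2.
have S_add x y : posball x -> posball y -> S (x + y) = S x + S y.
  move=> x_p y_p; rewrite -{1}(SK _ x_p) -{1}(SK _ y_p) -T_add ?TK //;
    by [exact: S_pos | apply: posballD; exact: S_pos].
have one_p (C : unitalCstarAlgType R) : posball (1 : C).
  by rewrite -(scale1r (1 : C)); exact: (@posball_scalar R C 1).
have [L [L_star LT]] := linear_extension_of_additive T T_pos T_add.
have [M [M_star MS]] := linear_extension_of_additive S S_pos S_add.
have LK : cancel L M.
  apply: (@eq_linear_on_posball R A A (M \o L) idfun) => a a_p /=.
  by rewrite LT // MS ?TK //; exact: T_pos.
have MK : cancel M L.
  apply: (@eq_linear_on_posball R B B (L \o M) idfun) => x x_p /=.
  by rewrite MS // LT ?SK //; exact: S_pos.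
have ww := posball_sa _ w_p.
(* [S 1 <= n] gives [1 <= n T 1]. *)
have v_inv : invertible (w ^+ 2).
  set n := nrm (S 1); have n0 : 0 <= n := nrm_ge0 _ _.
  have S1_p : posball (S 1) := S_pos _ (one_p B).
  have n1_p : posball (n%:C *: w ^+ 2 - 1).
    have -> : n%:C *: w ^+ 2 - 1 = T (n%:C *: (1 : A) - S 1).
      rewrite w2 -[X in _ - X](SK 1 (one_p B)) -LT // -[T (S 1)]LT // -[RHS]LT.
        by rewrite linearB linearZ.
      by apply: posball_sub_nrm => //; exact: posball_sa.
    by apply/T_pos/posball_sub_nrm => //; exact: posball_sa.
  (* [b] inverts [n w^2 = (n w^2 - 1) + 1], so [n b] inverts [w^2]; there is no division by [n],
     which is [0] in the zero algebra. *)
  have [b [nb bn]] := posball_invertible _ 1 n1_p ltr01.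
  rewrite scale1r subrK in nb bn.
  exists (n%:C *: b); split.
    by rewrite mulZr -mulZl; exact: nb.
  by rewrite mulZl -mulZr; exact: bn.
have [u [uu wu uw]] := invertible_sqr_sa w ww v_inv.
(* Conjugation by [u] makes [L] unital, as [L 1 = w ^+ 2]; [K] is the inverse of [J], and both
   preserve positivity. *)
pose J a := u * L a * u; pose K x := M (w * x * w).
have J_lin : linear J.
  by move=> c a b; rewrite /J linearP /=; nc_ring.
have K_lin : linear K.
  by move=> c x y; rewrite /K -linearP /=; congr (M _); nc_ring.
pose JJ : {linear A -> B} := HB.pack J (GRing.isLinear.Build _ _ _ _ J J_lin).
pose KK : {linear B -> A} := HB.pack K (GRing.isLinear.Build _ _ _ _ K K_lin).
have wJw a : w * J a * w = L a.
  by rewrite /J !mulrA wu mul1r -mulrA uw mulr1.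
have JK : cancel J K by move=> a; rewrite /K wJw LK.
have KJ : cancel K J.
  by move=> x; rewrite /K /J MK !mulrA uw mul1r -mulrA wu mulr1.
have J_pos a : posball a -> posball (J a).
  by move=> a_p; rewrite /J -{1}uu LT //; exact/posball_conj/T_pos.
have K_pos x : posball x -> posball (K x).
  move=> x_p; have wxw_p : posball (w * x * w) by rewrite -{1}ww; exact: posball_conj.
  by rewrite /K MS //; exact: S_pos.
have J1 : J 1 = 1.
  by rewrite /J LT // -w2 expr2 !mulrA uw mul1r wu.
exists J; split; last by move=> a a_p; rewrite wJw LT.
split.
- exact: J_lin.
- by exists K.
- exact: (jordan_of_order_isomorphism JJ KK JK KJ J_pos K_pos J1).
- by move=> a; rewrite /J L_star !star_mul uu mulrA.
Qed.

End NormAdditiveBijections.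

Theorem theorem2p1 (R : realType) (A B : unitalCstarAlgType R) (T : A -> B)
    (T_bij : set_bij (poscone A) (poscone B) T) :
  (forall a b : A, poscone A a -> poscone A b ->
     `|T (a + b)| = `|T a + T b|) <->
  (exists J : A -> B, jordan_star_isomorphism J /\
     forall a : A, poscone A a ->
       T a = possqrt (T 1) * J a * possqrt (T 1)).
Proof.
split=> [T_norm|[J [[J_lin _ _ _] TJ]] a b a_p b_p]; last first.
  have ab_p : poscone A (a + b) by apply/posconeE/posballD; exact/posconeE.
  rewrite (TJ _ ab_p) (TJ _ a_p) (TJ _ b_p); congr `|_|.
  have := J_lin 1 a b; rewrite !scale1r => ->.
  by rewrite mulrDr mulrDl.
have [T_pos T_inj T_surj] := T_bij.
pose S x := xget 0 [set a | poscone A a /\ T a = x].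
have SP x : posball x -> posball (S x) /\ T (S x) = x.
  move=> /posconeE/T_surj[a a_p Ta].
  have [] := @xgetPex _ 0 [set a | poscone A a /\ T a = x] _; first by exists a.
  by rewrite -/(S x) => /posconeE.
have T_posb a : posball a -> posball (T a) by move=> /posconeE/T_pos/posconeE.
have TK a : posball a -> S (T a) = a.
  move=> a_p; have [SaP SaT] := SP _ (T_posb _ a_p).
  by apply: T_inj => //; rewrite inE; apply/posconeE.
have T1_p : posball (T 1).
  by apply: T_posb; rewrite -(scale1r (1 : A)); exact: (@posball_scalar R A 1).
(* [posball_sqrt] supplies a root, so [possqrt] does not take its default value. *)
have [w_p w2] : poscone B (possqrt (T 1)) /\ possqrt (T 1) ^+ 2 = T 1.
  have [s [s_p s2 _]] := posball_sqrt _ T1_p.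
  apply: (@xgetPex _ 0 [set s : B | poscone B s /\ s ^+ 2 = T 1]).
  by exists s; split=> //; apply/posconeE.
have S_posb x : posball x -> posball (S x) by move=> /SP[].
have SK x : posball x -> T (S x) = x by move=> /SP[].
have T_add a b : posball a -> posball b -> T (a + b) = T a + T b.
  apply: (additive_of_norm_additive T S) => // {}a {}b /posconeE a_p /posconeE b_p.
  by rewrite /nrm T_norm.
have [J [J_jordan TJ]] := jordan_of_additive_bijection T S _
  T_posb S_posb TK SK T_add (proj1 (posconeE _) w_p) w2.
by exists J; split=> // a /posconeE; exact: TJ.
Qed.
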